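(* Let $E$ be a Borel space and $Q$ a semi-Markov kernel on $\mathbb{R}_+\times E$ given $E$, let $c,g:E\to[0,\infty)$ be bounded measurable functions, fix $T\in\mathbb{R}_+$, and suppose $\beta:=\sup_{x\in E}Q(T,E\mid x)<1$. For $\varepsilon>0$ let $$N_\varepsilon=\Big\lceil\frac{\log(\varepsilon(1-\beta))-\log(M+1)}{\log\beta}\Big\rceil,\qquad M=T\|c\|+\|g\|,$$ let $V^*_{N_\varepsilon}$ be the $N_\varepsilon$-th iterate defined by $V^*_0\equiv0$ and $V^*_{n+1}=\mathbb{G}V^*_n$ on $[0,T]\times E$, and let $D^\varepsilon=\{(s,x)\in(0,T]\times E: g(x)=\mathbb{G}V^*_{N_\varepsilon}(s,x)\}$. Then: (a) the map defined for $\omega=(x_0,t_1,x_1,\dots)\in\Omega$ by $$\tau^\varepsilon(\omega)=\inf\Big\{n\in\mathbb{N}: \Big(T-\sum_{k=1}^n t_k,x_n\Big)\in D^\varepsilon\Big\}\wedge\inf\Big\{n\in\mathbb{N}: T\le\sum_{k=1}^n t_k\Big\}$$ is an $\varepsilon$-$T$-optimal stopping time, i.e. $V^{\tau^\varepsilon}(T,x)-V^*(T,x)\le\varepsilon$ for all $x\in E$; (b) if moreover $\inf_{(s,x)\in((0,T]\times E)\setminus D^\varepsilon}\big(g(x)-\mathbb{G}V^*_{N_\varepsilon}(s,x)\big)>\varepsilon$, then $\tau^\varepsilon$ is also a $T$-optimal stopping time, i.e. $V^{\tau^\varepsilon}(T,x)=V^*(T,x)$ for all $x\in E$.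
   Context: $\|f\|=\sup_{x\in C}|f(x)|$ for a function $f$ on a set $C$; $\lceil y\rceil=\min\{n\in\mathbb{N}:n\ge y\}$, $\mathbb{N}=\{0,1,2,\dots\}$; $\inf\emptyset=+\infty$. Semi-Markov kernel: for each $B\in\mathcal{B}(E)$ and $x\in E$, $t\mapsto Q(t,B\mid x)$ is nondecreasing, right-continuous on $\mathbb{R}_+$ with $Q(0,B\mid x)=0$; for each $t$, $Q(t,\cdot\mid\cdot)$ is a substochastic kernel on $E$; $\lim_{t\to\infty}Q(t,\cdot\mid\cdot)$ is a stochastic kernel on $E$. Let $\Omega=\{(x_0,t_1,x_1,t_2,x_2,\dots): x_0\in E,\ (t_n,x_n)\in\mathbb{R}_+\times E\}$ with its product Borel $\sigma$-algebra; $X_n(\omega)=x_n$, $T_0=0$, $T_{n+1}(\omega)=t_{n+1}$, $S_n=\sum_{k=0}^n T_k$, $Y_n=(X_0,T_1,X_1,\dots,T_n,X_n)$, $\mathcal{F}_n=\sigma(T_0,X_0,\dots,T_n,X_n)$. For $x\in E$, $\mathbb{P}_x$ is the unique probability measure on $\Omega$ with $\mathbb{P}_x(T_0=0,X_0=x)=1$ and $\mathbb{P}_x(T_{n+1}\le t,X_{n+1}\in B\mid Y_n)=Q(t,B\mid X_n)$; $\mathbb{E}_x$ its expectation. $X(t)=X_n$ for $S_n\le t<S_{n+1}$. A stopping time is $\tau:\Omega\to\mathbb{N}\cup\{+\infty\}$ with $\{\tau=n\}\in\mathcal{F}_n$ for all $n$; $\Gamma$ is the set of stopping times. For $s\in\mathbb{R}_+$,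 $\tau\in\Gamma$: $R^s_\tau=\int_0^{S_\tau}c(X(t))\,dt+g(X(S_\tau))$ if $S_\tau<s$, and $R^s_\tau=\int_0^s c(X(t))\,dt$ if $S_\tau\ge s$ (with $S_\tau=\lim_nS_n$ on $\{\tau=\infty\}$); $V^\tau(s,x)=\mathbb{E}_x[R^s_\tau]$, $V^*(s,x)=\inf_{\tau\in\Gamma}V^\tau(s,x)$. For Borel $u:[0,T]\times E\to[0,\infty]$, $\mathbb{G}u(s,x)=\min\Big\{c(x)\int_0^s(1-Q(t,E\mid x))\,dt+\int_E\int_{[0,s]}u(s-t,y)\,Q(dt,dy\mid x),\ g(x)\Big\}$. *)

(* Defs.v *)
From HB Require Import structures.
From mathcomp Require Import all_boot all_order all_algebra.
From mathcomp Require Import all_classical all_reals all_analysis.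
Import Order.TTheory GRing.Theory Num.Theory.

Set Implicit Arguments.
Unset Strict Implicit.
Unset Printing Implicit Defensive.

Local Open Scope classical_set_scope.
Local Open Scope ring_scope.

(* Borel space: E is Borel-isomorphic to a Borel subset of the reals   *)
(* (Kuratowski: equivalent to being a Borel subset of a Polish space). *)
Definition borel_space (R : realType) d (E : measurableType d) : Prop :=
  exists f : E -> R, [/\ measurable_fun setT f, injective f &
    forall A : set E, measurable A -> measurable (f @` A)].

(* Canonical path space  Omega = E x (R x E)^N :
   w = (x_0, k |-> (t_{k+1}, x_{k+1})).                                *)
Definition paths (R : realType) d (E : measurableType d) :=
  (E * (nat -> R * E))%type.

HB.instance Definition _ (R : realType) d (E : measurableType d) :=
  Choice.on (paths R E).
HB.instance Definition _ (R : realType) d (E : measurableType d) :=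
  isPointed.Build (paths R E) (point, fun _ => (0, point)).

Section PathSpace.
Context {R : realType} {d : measure_display} {E : measurableType d}.

Definition Xc (n : nat) (w : paths R E) : E :=
  if n is k.+1 then (w.2 k).2 else w.1.
Definition Tc (n : nat) (w : paths R E) : R :=
  if n is k.+1 then (w.2 k).1 else 0.
Definition Sc (n : nat) (w : paths R E) : R := \sum_(0 <= k < n.+1) Tc k w.

Definition coord_gen (n : nat) : set (set (paths R E)) :=
  [set A | exists k, (k <= n)%N /\
      exists B : set E, measurable B /\ A = Xc k @^-1` B] `|`
  [set A | exists k, (k <= n)%N /\
      exists B : set R, measurable B /\ A = Tc k @^-1` B].

Definition filtr (n : nat) : set (set (paths R E)) := <<s coord_gen n >>.

Definition all_gen : set (set (paths R E)) := \bigcup_n coord_gen n.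

End PathSpace.

Definition Omega (R : realType) d (E : measurableType d) :=
  g_sigma_algebraType (@all_gen R d E).

Section Defs.
Context {R : realType} {d : measure_display} {E : measurableType d}.
Local Notation paths := (paths R E).

(* inf of a set of naturals in N u {+oo}; None stands for +oo = inf set0 *)
Definition oinf (P : nat -> Prop) : option nat :=
  match pselect (exists n, P n) with
  | left h => Some (@ex_minn (fun n => `[< P n >])
                     (let: ex_intro n hn := h in ex_intro _ n (asboolT hn)))
  | right _ => None
  end.

Definition omin (a b : option nat) : option nat :=
  match a, b with
  | Some m, Some n => Some (minn m n)
  | Some m, None => Some m
  | None, b => b
  end.

Definition stopping_time (tau : paths -> option nat) : Prop :=
  forall n : nat, filtr n [set w | tau w = Some n].

Definition Sinf (w : paths) : \bar R := limn (fun n => (Sc n w)%:E).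

(* X(t) = X_n for S_n <= t < S_{n+1}  (convention: X_0 if there is no
   such n, which only happens on a null set) *)
Definition Xt (w : paths) (t : R) : E :=
  match oinf (fun n => Sc n w <= t < Sc n.+1 w) with
  | Some n => Xc n w
  | None => Xc 0 w
  end.

Definition S_at (tau : paths -> option nat) (w : paths) : \bar R :=
  match tau w with Some n => (Sc n w)%:E | None => Sinf w end.

Definition reward (c g : E -> R) (tau : paths -> option nat) (s : R)
    (w : paths) : \bar R :=
  (let S := S_at tau w in
   if S < s%:E then
     \int[lebesgue_measure]_(t in `[0%R, fine S]) (c (Xt w t))%:E
       + (g (Xt w (fine S)))%:E
   else \int[lebesgue_measure]_(t in `[0%R, s]) (c (Xt w t))%:E)%E.

Definition value (P : E -> probability (Omega R E) R) (c g : E -> R)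
    (tau : paths -> option nat) (s : R) (x : E) : \bar R :=
  \int[P x]_w reward c g tau s w.

Definition Vstar (P : E -> probability (Omega R E) R) (c g : E -> R)
    (s : R) (x : E) : \bar R :=
  ereal_inf [set value P c g tau s x | tau in stopping_time].

(* semi-Markov kernel given through its measure Q(dt, dy | x) on R x E;
   Q(t, B | x) := Q([0,t] x B | x)  (the measure is carried by (0,oo) x E) *)
Definition Qd (Qk : R.-pker E ~> (R * E)%type) (t : R) (B : set E) (x : E)
  : R := fine (Qk x (`]-oo, t] `*` B)).

Definition Gop (Qk : R.-pker E ~> (R * E)%type) (c g : E -> R)
    (u : R -> E -> \bar R) (s : R) (x : E) : \bar R :=
  Order.min
    ((c x)%:E * (\int[lebesgue_measure]_(t in `[0%R, s]) (1 - Qd Qk t setT x)%:E)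
      + \int[Qk x]_(p in `[0%R, s] `*` setT) u (s - p.1)%R p.2)%E
    (g x)%:E.

Definition Vn (Qk : R.-pker E ~> (R * E)%type) (c g : E -> R) (n : nat)
  : R -> E -> \bar R := iter n (Gop Qk c g) (fun _ _ => 0%E).

Definition supnorm (f : E -> R) : R := sup (range (fun x => `|f x|)).

Definition beta (Qk : R.-pker E ~> (R * E)%type) (T : R) : R :=
  sup (range (Qd Qk T setT)).

(* ceil y = min {n in N : n >= y} *)
Definition natceil (y : R) : nat := if 0 < y then absz (Num.ceil y) else 0%N.

(* N_eps  (for beta = 0, log beta = -oo and the quotient is read as 0) *)
Definition Neps (Qk : R.-pker E ~> (R * E)%type) (c g : E -> R) (T eps : R)
  : nat :=
  let b := beta Qk T in
  let M := T * supnorm c + supnorm g in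
  if b == 0 then 0%N
  else natceil ((ln (eps * (1 - b)) - ln (M + 1)) / ln b).

Definition Deps (Qk : R.-pker E ~> (R * E)%type) (c g : E -> R) (T eps : R)
  : set (R * E) :=
  [set sx | 0 < sx.1 <= T /\
            (g sx.2)%:E = Gop Qk c g (Vn Qk c g (Neps Qk c g T eps)) sx.1 sx.2].

Definition tau_eps (Qk : R.-pker E ~> (R * E)%type) (c g : E -> R) (T eps : R)
    (w : paths) : option nat :=
  omin (oinf (fun n => Deps Qk c g T eps (T - Sc n w, Xc n w)))
       (oinf (fun n => T <= Sc n w)).

End Defs.

(* Main.v *)
Require Import Defs.
From HB Require Import structures.
From mathcomp Require Import all_boot all_order all_algebra.
From mathcomp Require Import all_classical all_reals all_analysis.
From mathcomp Require Import measurable_realfun ring.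
Import Order.TTheory GRing.Theory Num.Theory.
Set Implicit Arguments.
Unset Strict Implicit.
Unset Printing Implicit Defensive.
Local Open Scope classical_set_scope.
Local Open Scope ring_scope.

(** Idea. Up to a null set, the reward of a stopping time tau is the sum over k of
    its stage rewards: the running cost on [S_k, S_(k+1)) while k < tau, and g(X_k)
    at k = tau, as long as S_k < T. By the Markov property, for u vanishing at
    nonpositive remaining times, the expected k-th stage reward plus
    E[u(T - S_(k+1), X_(k+1)); tau >= k+1] equals
    E[g(X_k); tau = k] + E[(H u)(T - S_k, X_k); tau > k], where G u = min(H u, g).
    With u = V_n and V_(n+1) <= min(H V_n, g), telescoping down to V_0 = 0 yields
    V_n <= V^tau for every tau. Conversely, let tau be the hitting time of
    {g = V_(m+1)}, so that V_(m+1) = H V_m before tau. As H contracts by beta on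
    [0,T] and P(S_k < T) <= beta^k, taking u = V_(m+1) gives
    V^tau <= V_(m+1) + beta^(m+1) |g| / (1 - beta). For m = N_eps the last term is at
    most eps, which is (a). Under the gap hypothesis of (b) the stopping region is
    the same for all m >= N_eps, and m tends to infinity. *)

(** * Disintegration along a kernel *)

Section Disintegration.
Context {R : realType} {d0 d1 d2 d3 : measure_display}
  {W : measurableType d0} {Z : measurableType d1}
  {X : measurableType d2} {Y : measurableType d3}.
Variables (mu : probability W R) (k : R.-pker X ~> Y).
Variables (z : W -> Z) (e : W -> X) (y : W -> Y).
Hypotheses (mz : measurable_fun setT z) (me : measurable_fun setT e)
  (my : measurable_fun setT y).
Local Open Scope ereal_scope.

(** The measure [mu] in the form of a kernel, so that [kcomp] can build the joint law from it. *)
Definition kconst (_ : unit) : {measure set W -> \bar R} := mu.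

Let measurable_kconst U : measurable U -> measurable_fun setT (kconst ^~ U).
Proof. by move=> mU; exact: measurable_cst. Qed.

HB.instance Definition _ :=
  @isKernel.Build _ _ _ _ R kconst measurable_kconst.

Let kconst_prob t : kconst t setT = 1.
Proof. exact: probability_setT. Qed.

HB.instance Definition _ :=
  @Kernel_isProbability.Build _ _ _ _ R kconst kconst_prob.

(** The law of the pair [(z w, v)] when [v] is drawn from [k (e w)]. The unit factor is imposed by
    the shape of [kcomp]. *)
Definition kgraph (uw : unit * W) : set (Z * Y) -> \bar R :=
  pushforward (k (e uw.2)) (pair (z uw.2)).

Let kgraph0 uw : kgraph uw set0 = 0.
Proof. by rewrite /kgraph /pushforward preimage_set0 measure0. Qed.

Let kgraph_ge0 uw A : 0 <= kgraph uw A.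
Proof. exact: measure_ge0. Qed.

Let kgraph_sigma_additive uw : semi_sigma_additive (kgraph uw).
Proof.
exact: (@measure_semi_sigma_additive _ _ _
  (measure_function_pushforward__canonical__measure_function_Measure
    (k (e uw.2)) (pair1_measurable (z uw.2)))).
Qed.

HB.instance Definition _ uw := isMeasure.Build _ _ _ (kgraph uw)
  (kgraph0 uw) (kgraph_ge0 uw) (@kgraph_sigma_additive uw).

Definition mkgraph (uw : unit * W) : {measure set (Z * Y) -> \bar R} :=
  kgraph uw.

Let measurable_kgraph U : measurable U -> measurable_fun setT (mkgraph ^~ U).
Proof.
move=> mU.
(* [kernel_snd k] is [k] seen as a kernel from [Z * X]. The set [V] of triples carries [U] along
   with a dummy second coordinate, so measurability of sections applies. *)
have mzx : measurable_fun setT (fun p : Z * X => k p.2 (xsection U p.1)).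
  have mV : measurable [set q : (Z * X) * Y | U (q.1.1, q.2)].
    rewrite -[X in measurable X]setTI.
    have : measurable_fun setT (fun q : (Z * X) * Y => (q.1.1, q.2)).
      by apply: measurable_fun_pair => //; exact: measurableT_comp.
    exact.
  have := @measurable_fun_xsection_finite_kernel _ _ _ _ _
    (kernel.kernel_snd k) _ (mem_set mV).
  apply: eq_measurable_fun => -[z' x'] _ /=.
  by congr (k x' _); apply/seteqP; split=> t; rewrite /xsection/= !inE.
rewrite [X in measurable_fun _ X](_ : _ = 
  (fun p : Z * X => k p.2 (xsection U p.1)) \o (fun uw => (z uw.2, e uw.2))).
  apply: measurableT_comp => //.
  by apply: measurable_fun_pair; exact: measurableT_comp.
apply/funext => uw /=; rewrite /mkgraph /kgraph /pushforward.
by congr (k _ _); apply/seteqP; split => t; rewrite /xsection/= inE.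
Qed.

HB.instance Definition _ :=
  @isKernel.Build _ _ _ _ R mkgraph measurable_kgraph.

Let mkgraph_prob uw : mkgraph uw setT = 1.
Proof. exact: (prob_kernel (e uw.2)). Qed.

HB.instance Definition _ :=
  @Kernel_isProbability.Build _ _ _ _ R mkgraph mkgraph_prob.

(** Both sides integrate [phi] against a measure on [Z * Y]: the law of [(z, y)], and the
    composition of [mu] with the graph kernel. By [H] the two agree on the rectangles with second
    side in the pi-system [G], and the sets [F n] exhaust the space, so they are equal. *)
Lemma disintegration (G : set (set Y)) (F : (set Y)^nat) (phi : Z * Y -> \bar R) :
  @measurable _ Y = <<s G >> -> setI_closed G ->
  (forall n, G (F n)) -> \bigcup_n F n = setT ->
  (forall (A : set Z) (B : set Y), measurable A -> G B ->
    mu (z @^-1` A `&` y @^-1` B) = \int[mu]_(w in z @^-1` A) k (e w) B) ->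
  measurable_fun setT phi -> (forall p, 0 <= phi p) ->
  \int[mu]_w phi (z w, y w) = \int[mu]_w \int[k (e w)]_v phi (z w, v).
Proof.
move=> YG GI GF FT H mphi phi0.
have mzy : measurable_fun setT (fun w => (z w, y w)).
  exact: measurable_fun_pair.
have mG B : G B -> measurable B by move=> GB; rewrite YG; exact: sub_sigma_algebra.
transitivity (\int[pushforward mu (fun w => (z w, y w))]_p phi p).
  by rewrite ge0_integral_pushforward.
transitivity (\int[kcomp kconst mkgraph tt]_p phi p); last first.
  rewrite integral_kcomp//; apply: eq_integral => w _.
  by rewrite ge0_integral_pushforward//; exact: pair1_measurable.
apply: eq_measure_integral => C mC _.
pose H' := [set A `*` B | A in @measurable _ Z & B in G].
pose m1 := measure_function_pushforward__canonical__measure_function_Measure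
  mu mzy.
apply: (@measure_unique _ _ _ H' (fun n => setT `*` F n) _ _ _ _ m1) => //.
- rewrite eqEsubset; split; last first.
    apply: smallest_sub => //; first exact: sigma_algebra_measurable.
    by move=> _ [A mA [B GB <-]]; apply: measurableX => //; exact: mG.
  rewrite measurable_prod_measurableType; apply: smallest_sub.
    exact: smallest_sigma_algebra.
  (* Good sets: the [B] whose cylinder is generated by [H'] form a sigma-algebra containing [G]. *)
  have mT B : measurable B -> <<s H'>> ((setT : set Z) `*` B).
    rewrite YG => GB.
    suff : <<s G>> `<=` [set B | <<s H' >> ((setT : set Z) `*` B)] by exact.
    apply: smallest_sub; last first.
      by move=> B' GB'; apply: sub_sigma_algebra; exists setT => //; exists B'.
    have [s0 sC sU] := @smallest_sigma_algebra _ (setT : set (Z * Y)) H'.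
    split => /=.
    + by rewrite setX0.
    + move=> B' hB'; rewrite (_ : _ `*` _ = setT `\` (setT `*` B')).
        exact: sC.
      by apply/seteqP; split => -[a b] /=; tauto.
    + by move=> A hA; rewrite setX_bigcupr; exact: sU.
  move=> _ [A mA [B mB <-]].
  (* [G] need not contain the whole space, so the cylinder over [A] is recovered from the exhausting
     sequence. *)
  have -> : A `*` B = \bigcup_n (A `*` F n) `&` (setT `*` B).
    rewrite -setX_bigcupr FT.
    by apply/seteqP; split => -[a b] /=; tauto.
  apply: (@measurableI _ (g_sigma_algebraType H')); last exact: mT.
  apply: (@bigcup_measurable _ (g_sigma_algebraType H')) => n _.
  by apply: sub_sigma_algebra; exists A => //; exists (F n).
- move=> _ _ [A1 mA1 [B1 GB1 <-]] [A2 mA2 [B2 GB2 <-]].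
  exists (A1 `&` A2); first exact: measurableI.
  by exists (B1 `&` B2); [exact: GI|rewrite setXI].
- by move=> n; exists setT => //; exists (F n).
- by rewrite -setX_bigcupr FT setXTT.
- move=> _ [A mA [B GB <-]] /=.
  transitivity (mu (z @^-1` A `&` y @^-1` B)); first by [].
  rewrite H// integral_mkcond; apply: eq_integral => w _.
  transitivity (k (e w) (pair (z w) @^-1` (A `*` B))); last by [].
  rewrite patchE; case: ifPn => [|]; rewrite ?inE ?notin_setE /= => Aw.
    by congr (k _ _); apply/seteqP; split => t //= [].
  rewrite (_ : _ @^-1` _ = set0) ?measure0//.
  by apply/seteqP; split => t //= [].
- move=> n /=; rewrite /pushforward.
  apply: (le_lt_trans (probability_le1 _ _)); last exact: ltry.
  rewrite -[X in measurable X]setTI; apply: (mzy measurableT).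
  by apply: measurableX => //; exact: mG.
Qed.

End Disintegration.

(** * Path space *)

(** As a type of its own, the path space with the sigma-algebra F_n lets [measurable_fun] express
    F_n-measurability. *)
Definition Filt (R : realType) d (E : measurableType d) (n : nat) :=
  g_sigma_algebraType (@coord_gen R d E n).

Section PathMeasurability.
Context {R : realType} {d : measure_display} {E : measurableType d}.

Lemma filtr_measurable n (A : set (Omega R E)) : filtr n A -> measurable A.
Proof.
move=> nA; suff : @filtr R d E n `<=` <<s all_gen >> by exact.
by apply: sub_sigma_algebra2 => B nB; exists n.
Qed.

Lemma filtr_le m n (A : set (paths R E)) : (m <= n)%N -> filtr m A -> filtr n A.
Proof.
move=> mn; apply: sub_sigma_algebra2 => B [[k [km BE]]|[k [km BE]]].
  by left; exists k; split => //; exact: leq_trans mn.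
by right; exists k; split => //; exact: leq_trans mn.
Qed.

Lemma measurable_Xc n k : (k <= n)%N ->
  measurable_fun setT (Xc k : Filt R E n -> E).
Proof.
move=> kn _ B mB; rewrite setTI; apply: sub_sigma_algebra.
by left; exists k; split => //; exists B.
Qed.

Lemma measurable_Tc n k : (k <= n)%N ->
  measurable_fun setT (Tc k : Filt R E n -> R).
Proof.
move=> kn _ B mB; rewrite setTI; apply: sub_sigma_algebra.
by right; exists k; split => //; exists B.
Qed.

Lemma measurable_Sc n k : (k <= n)%N ->
  measurable_fun setT (Sc k : Filt R E n -> R).
Proof.
move=> kn; rewrite [X in measurable_fun _ X](_ : _ = fun w : Filt R E n =>
    \sum_(i < k.+1) Tc i w); last first.
  by apply/funext => w; rewrite /Sc big_mkord.
apply: measurable_sum => i; apply: measurable_Tc.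
by rewrite (leq_trans _ kn)// -ltnS.
Qed.

Lemma measurable_filt_id n :
  measurable_fun setT (id : Omega R E -> Filt R E n).
Proof. by move=> _ A mA; rewrite setTI; exact: (@filtr_measurable n). Qed.

Lemma measurable_filt_Omega n d' (T : measurableType d') (f : Filt R E n -> T) :
  measurable_fun setT f -> measurable_fun setT (f : Omega R E -> T).
Proof.
move=> mf _ B mB; rewrite setTI; apply: (@filtr_measurable n).
by have := mf measurableT B mB; rewrite setTI.
Qed.

Lemma ScS n (w : paths R E) : Sc n.+1 w = Sc n w + Tc n.+1 w.
Proof. by rewrite /Sc big_nat_recr. Qed.

Lemma Sc0 (w : paths R E) : Sc 0 w = 0.
Proof. by rewrite /Sc big_nat1. Qed.

(** The pi-system on which the law of the next jump is prescribed. *)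
Definition initial_boxes : set (set (R * E)) :=
  [set C | exists t B, measurable B /\ C = `]-oo, t] `*` B].

(** Complements of boxes give the open rays, hence all cylinders over the time coordinate. Unions of
    boxes give the cylinders over [E], and a rectangle is the intersection of two cylinders. *)
Lemma initial_boxes_gen : @measurable _ (R * E)%type = <<s initial_boxes >>.
Proof.
rewrite eqEsubset; split; last first.
  apply: smallest_sub; first exact: sigma_algebra_measurable.
  by move=> _ [t [B [mB ->]]]; exact: measurableX.
have [s0 sC sU] := @smallest_sigma_algebra _ (setT : set (R * E)) initial_boxes.
have mbox t B : measurable B -> <<s initial_boxes >> (`]-oo, t] `*` B).
  move=> mB; apply: (@sub_sigma_algebra _ setT initial_boxes).
  by exists t; exists B.
have sfst B : measurable B -> <<s initial_boxes >> (B `*` setT).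
  have -> : @measurable _ R = <<s @RGenOInfty.G R >>.
    exact: RGenOInfty.measurableE.
  suff : <<s @RGenOInfty.G R >> `<=` [set B | <<s initial_boxes >> (B `*` setT)].
    exact.
  apply: smallest_sub; last first.
    move=> _ [t ->] /=.
    rewrite (_ : _ `*` _ = setT `\` (`]-oo, t] `*` setT)).
      by apply: sC; exact: mbox.
    apply/seteqP; split => -[u v] /=; rewrite !in_itv/= andbT ltNge.
      by move=> [/negP ut _]; split => // -[/ut].
    by move=> [_ tu]; split => //; apply/negP => ut; exact: tu.
  split => /=; first by rewrite set0X.
    move=> B' hB'; rewrite (_ : _ `*` _ = setT `\` (B' `*` setT)).
      exact: sC.
    by apply/seteqP; split => -[a b] /=; tauto.
  by move=> A hA; rewrite setX_bigcupl; exact: sU.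
have ssnd B : measurable B -> <<s initial_boxes >> (setT `*` B).
  move=> mB; rewrite (_ : _ `*` _ = \bigcup_n (`]-oo, n%:R] `*` B)).
    by apply: sU => n; exact: mbox.
  apply/seteqP; split => -[u v] /= => [[_ Bv]|[n _ []]//].
  exists (Num.truncn u).+1 => //=; split => //.
  by rewrite in_itv/= ltW// truncnS_gt.
rewrite measurable_prod_measurableType; apply: smallest_sub.
  exact: smallest_sigma_algebra.
move=> _ [A mA [B mB <-]].
rewrite (_ : _ `*` _ = (A `*` setT) `&` (setT `*` B)).
  (* De Morgan: only closure under complement and countable union is available here. *)
  have -> : (A `*` setT) `&` (setT `*` B) = setT `\`
      \bigcup_n (setT `\` (if n is 0%N then A `*` setT else setT `*` B)).
    apply/seteqP; split => [p [pA pB]|p [_ H]].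
      by split => // -[[|n] _ []].
    by split; apply: contrapT => np; apply: H; [exists 0%N|exists 1%N].
  by apply: (sC); apply: sU => -[|n]; apply: sC; [exact: sfst|exact: ssnd].
by apply/seteqP; split => -[a b] /=; tauto.
Qed.

End PathMeasurability.

(** * Markov property at a jump, for nonnegative functions *)

Section MarkovStep.
Context {R : realType} {d : measure_display} {E : measurableType d}.
Variables (Qk : R.-pker E ~> (R * E)%type) (P : probability (Omega R E) R).
Hypothesis HP1 : forall (n : nat) (A : set (Omega R E)), filtr n A ->
  forall (t : R) (B : set E), measurable B ->
  P (A `&` [set w | Tc n.+1 w <= t /\ B (Xc n.+1 w)]) =
  (\int[P]_(w in A) (Qd Qk t B (Xc n w))%:E)%E.
Local Open Scope ereal_scope.

Lemma Qd_EFin t B x : measurable B -> (Qd Qk t B x)%:E = Qk x (`]-oo, t] `*` B).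
Proof.
move=> mB; rewrite /Qd fineK//.
have mtB : measurable (`]-oo, t] `*` B) by exact: measurableX.
rewrite ge0_fin_numE//; apply: le_lt_trans (ltry 1).
by rewrite -(prob_kernel (s := Qk) x) le_measure// ?inE.
Qed.

(** [HP1] is the case where [h] is the indicator of a box in the jump pair; [disintegration] extends
    it from this pi-system. The event [A] is absorbed into the integrand as an indicator. *)
Lemma markov_step n (A : set (Omega R E)) (h : (R * E) * (R * E) -> \bar R) :
  filtr n A -> measurable_fun setT h -> (forall p, 0 <= h p) ->
  \int[P]_(w in A) h ((Sc n w, Xc n w), (Tc n.+1 w, Xc n.+1 w)) =
  \int[P]_(w in A) \int[Qk (Xc n w)]_p h ((Sc n w, Xc n w), p).
Proof.
move=> nA mh h0; rewrite integral_mkcond [RHS]integral_mkcond.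
have mA : measurable (A : set (Filt R E n)) by exact: nA.
pose phi (q : Filt R E n * (R * E)) :=
  h ((Sc n q.1, Xc n q.1), q.2) * (\1_A q.1)%:E.
have mSX : measurable_fun setT
    (fun q : Filt R E n * (R * E) => ((Sc n q.1, Xc n q.1), q.2)).
  apply: measurable_fun_pair => //; apply: measurable_fun_pair.
    by apply: (measurableT_comp (measurable_Sc (leqnn n))).
  by apply: (measurableT_comp (measurable_Xc (leqnn n))).
have mphi : measurable_fun setT phi.
  apply: emeasurable_funM; first exact: (measurableT_comp mh mSX).
  apply/measurable_EFinP.
  have mI : measurable_fun setT (\1_A : Filt R E n -> R).
    exact: measurable_indic.
  exact: (measurableT_comp mI (@measurable_fst _ _ _ _)).
have phi0 p : 0 <= phi p by rewrite /phi mule_ge0.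
have mX : measurable_fun setT (Xc n : Omega R E -> E).
  by apply: measurable_filt_Omega; exact: measurable_Xc.
have mTX : measurable_fun setT
    (fun w : Omega R E => (Tc n.+1 w, Xc n.+1 w)).
  apply: measurable_fun_pair; apply: (@measurable_filt_Omega _ _ _ n.+1).
    exact: measurable_Tc.
  exact: measurable_Xc.
(* Take the first coordinate to be the path itself, in the sigma-algebra F_n. *)
transitivity (\int[P]_w phi (w, (Tc n.+1 w, Xc n.+1 w))).
  by apply: eq_integral => w _; rewrite epatch_indic.
rewrite (@disintegration R _ _ _ _ (Omega R E) (Filt R E n) _ _ P Qk id (Xc n) _ _ _ _
    initial_boxes (fun n => `]-oo, n%:R] `*` setT))//.
- apply: eq_integral => w _; rewrite epatch_indic /phi/=.
  by rewrite ge0_integralZr//; exact: (measurable_fun_pair2 _ mh).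
- exact: measurable_filt_id.
- exact: initial_boxes_gen.
- move=> _ _ [t [B [mB ->]]] [u [C [mC ->]]].
  exists (Num.min t u); exists (B `&` C); split; first exact: measurableI.
  rewrite -setXI; congr (_ `*` _).
  by apply/seteqP; split => x /=; rewrite !in_itv/= le_min => /andP.
- by move=> m; exists m%:R; exists setT.
- apply/seteqP; split => // -[u v] _; exists (Num.truncn u).+1 => //=.
  by split => //; rewrite in_itv/= ltW// truncnS_gt.
- move=> A' _ mA' [t [B [mB ->]]].
  transitivity (P (A' `&` [set w | (Tc n.+1 w <= t)%R /\ B (Xc n.+1 w)])).
    by congr (P (_ `&` _)); apply/seteqP; split => w /=; rewrite in_itv.
  rewrite HP1//; apply: eq_integral => w _.
  by rewrite Qd_EFin.
Qed.

End MarkovStep.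

(** * Dynamic programming operator *)

(** Layer-cake formula: the integrand on the left is the Lebesgue measure of the [t] in [0, s] with
    [t < f p], and Tonelli exchanges the two integrals. *)
Lemma truncated_tail_integral (R : realType) d (T : measurableType d)
    (m : probability T R) (f : T -> R) (s : R) : measurable_fun setT f ->
  (\int[m]_p (Num.max 0 (Num.min (f p) s))%:E =
   \int[lebesgue_measure]_(t in `[0%R, s]) m [set p | t < f p]%R)%E.
Proof.
move=> mf.
pose k (q : T * R) : \bar R := (\1_`[0%R, s] q.2 * (q.2 < f q.1)%R%:R)%:E.
have mk : measurable_fun setT k.
  apply/measurable_EFinP; apply: measurable_funM.
    exact: (measurableT_comp (measurable_indic (measurable_itv _))).
  rewrite [X in measurable_fun _ X](_ : _ =
      fun q : T * R => if q.2 < f q.1 then 1 else 0); last first.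
    by apply/funext => q; case: ifP.
  apply: measurable_fun_ifT => //; apply: measurable_fun_ltr => //.
  exact: measurableT_comp.
have k0 q : (0 <= k q)%E by rewrite lee_fin mulr_ge0.
transitivity (\int[m]_p \int[lebesgue_measure]_t k (p, t))%E.
  apply: eq_integral => p _.
  have -> : (fun t : R => k (p, t)) = EFin \o \1_(`[0%R, s] `&` `]-oo, f p[).
    apply/funext => t; rewrite /k indicI/=; congr (_ * _)%:E.
    rewrite indicE; congr (nat_of_bool _)%:R.
    by apply/idP/idP; rewrite inE/= in_itv.
  rewrite integral_indic//; last exact: measurableI.
  rewrite setIT; apply/esym.
  transitivity (lebesgue_measure (`[0%R, s]%classic `&` `]-oo, f p[%classic)) => //.
  have [fs|sf] := ltP (f p) s.
    rewrite (_ : _ `&` _ = [set` `[0%R, f p[]); last first.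
      apply/seteqP; split => t /=; rewrite !in_itv/=.
        by move=> [/andP[-> _] ->].
      by move=> /andP[-> tf]; rewrite tf (le_trans (ltW tf) (ltW fs)).
    rewrite lebesgue_measure_itv/= lte_fin; case: ltP => // f0.
    by rewrite -EFinD subr0.
  rewrite (_ : lebesgue_measure _ = lebesgue_measure [set` `[0%R, s[]).
    rewrite lebesgue_measure_itv/= lte_fin; case: ltP => // s0.
    by rewrite -EFinD subr0.
  (* As [t < f p] is strict, [f p = s] leaves [0, s[ and [f p > s] leaves [0, s]; both have the same
     measure. *)
  have [/eqP fps|fps] := eqVneq (f p) s.
    rewrite (_ : _ `&` _ = [set` `[0%R, s[])//.
    apply/seteqP; split => t /=; rewrite !in_itv/= (eqP fps).
      by move=> [/andP[-> _] ->].
    by move=> /andP[-> ts]; rewrite ts ltW.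
  rewrite (_ : _ `&` _ = [set` `[0%R, s]]).
    by rewrite !lebesgue_measure_itv.
  apply/seteqP; split => t /=; rewrite !in_itv/=; first by case.
  move=> /andP[-> ts]; split => //.
  by rewrite (le_lt_trans ts)// lt_neqAle eq_sym fps.
rewrite (@fubini_tonelli _ _ _ _ _ m lebesgue_measure k mk k0) [RHS]integral_mkcond.
apply: eq_integral => t _; rewrite patchE.
have mtf : measurable [set p | t < f p].
  have := mf measurableT `]t, +oo[%classic (measurable_itv _).
  rewrite setTI; congr measurable.
  by apply/seteqP; split => p /=; rewrite in_itv/= andbT.
case: ifPn => [ts|ts].
  rewrite -[X in _ = m X]setIT -integral_indic//; apply: eq_integral => p _.
  rewrite /k/= indicE ts mul1r indicE; congr (nat_of_bool _)%:R%:E.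
  by apply/idP/idP; rewrite inE.
by apply: integral0_eq => p _; rewrite /k/= indicE (negbTE ts) mul0r.
Qed.

Section KernelProbability.
Context {R : realType} {d d' : measure_display} {X : measurableType d}
  {Y : measurableType d'}.
Variables (k : R.-pker X ~> Y) (x : X).

(** Equips [k x] with the structure of a probability, as required by [truncated_tail_integral]. *)
Definition kprob : set Y -> \bar R := k x.

HB.instance Definition _ := isMeasure.Build _ _ _ kprob
  (measure0 (k x)) (fun A => measure_ge0 (k x) A)
  (@measure_semi_sigma_additive _ _ _ (k x)).

HB.instance Definition _ :=
  Measure_isProbability.Build _ _ _ kprob (prob_kernel x).

End KernelProbability.

Section Operator.
Context {R : realType} {d : measure_display} {E : measurableType d}.
Variables (Qk : R.-pker E ~> (R * E)%type) (c g : E -> R).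
Hypotheses (mc : measurable_fun setT c) (mg : measurable_fun setT g)
  (c0 : forall x, 0 <= c x) (g0 : forall x, 0 <= g x).
Local Open Scope ereal_scope.
Local Notation uncurried u := (fun q : R * E => u q.1 q.2).
Implicit Types u v : R -> E -> \bar R.

(** Running cost of a sojourn of length [t] in [x], cut at the remaining time [s]. The maximum keeps
    it nonnegative for negative [s] or [t], which the types allow. *)
Definition stage_cost (s : R) (x : E) (t : R) : R :=
  (c x * Num.max 0 (Num.min t s))%R.

(* Since c(x) \int_0^s (1 - Q(t,E|x)) dt = \int c(x) min(t,s) Q(dt,E|x), the first
   argument of the minimum in [Gop] is a single integral of [one_step u] against
   the kernel; joint measurability in (s,x) and the Markov property apply to it
   directly. *)
Definition one_step (u : R -> E -> \bar R) (q : (R * E) * (R * E)) : \bar R :=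
  (stage_cost q.1.1 q.1.2 q.2.1)%:E +
  (if (0 <= q.2.1 <= q.1.1)%R then u (q.1.1 - q.2.1)%R q.2.2 else 0).

Definition Hop (u : R -> E -> \bar R) (s : R) (x : E) : \bar R :=
  \int[Qk x]_p one_step u ((s, x), p).

Lemma stage_cost_ge0 s x t : (0 <= stage_cost s x t)%R.
Proof. by rewrite mulr_ge0// le_max lexx. Qed.

Lemma one_step_ge0 u q : (forall s x, 0 <= u s x) -> 0 <= one_step u q.
Proof.
move=> u0; rewrite adde_ge0//; first by rewrite lee_fin stage_cost_ge0.
by case: ifP.
Qed.

Lemma measurable_stage_cost :
  measurable_fun setT
    (fun q : (R * E) * (R * E) => stage_cost q.1.1 q.1.2 q.2.1).
Proof.
apply: measurable_funM.
  apply: (measurableT_comp mc).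
  exact: (measurableT_comp (@measurable_snd _ _ _ _)).
apply: measurable_maxr => //; apply: measurable_minr.
  exact: (measurableT_comp (@measurable_fst _ _ _ _)).
exact: (measurableT_comp (@measurable_fst _ _ _ _)).
Qed.

Lemma measurable_continuation u : measurable_fun setT (uncurried u) ->
  measurable_fun setT (fun q : (R * E) * (R * E) =>
    if (0 <= q.2.1 <= q.1.1)%R then u (q.1.1 - q.2.1)%R q.2.2 else 0).
Proof.
move=> mu.
have m11 : measurable_fun setT (fun q : (R * E) * (R * E) => q.1.1).
  exact: (measurableT_comp (@measurable_fst _ _ _ _)).
have m21 : measurable_fun setT (fun q : (R * E) * (R * E) => q.2.1).
  exact: (measurableT_comp (@measurable_fst _ _ _ _)).
have m22 : measurable_fun setT (fun q : (R * E) * (R * E) => q.2.2).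
  exact: (measurableT_comp (@measurable_snd _ _ _ _)).
apply: measurable_fun_ifT => //.
  by apply: measurable_and; apply: measurable_fun_ler.
have mD : measurable_fun setT
    (fun q : (R * E) * (R * E) => ((q.1.1 - q.2.1)%R, q.2.2)).
  by apply: measurable_fun_pair => //; exact: measurable_funB.
exact: (measurableT_comp mu mD).
Qed.

Lemma measurable_one_step u : measurable_fun setT (uncurried u) ->
  measurable_fun setT (one_step u).
Proof.
move=> mu; apply: emeasurable_funD; last exact: measurable_continuation.
apply/measurable_EFinP; exact: measurable_stage_cost.
Qed.

Lemma measurable_Hop u : (forall s x, 0 <= u s x) ->
  measurable_fun setT (uncurried u) ->
  measurable_fun setT (uncurried (Hop u)).
Proof.
move=> u0 mu.
have := measurable_fun_integral_finite_kernel (one_step u) (kernel.kernel_snd Qk).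
move=> /(_ (fun q => one_step_ge0 q u0) (measurable_one_step mu)).
by move=> mH; apply: eq_measurable_fun mH => -[s x] _.
Qed.

Lemma Qd_ge0 t B x : (0 <= Qd Qk t B x)%R.
Proof. exact: fine_ge0. Qed.

Lemma Qd_compl t x : 1 - (Qd Qk t setT x)%:E = Qk x [set p | t < p.1]%R.
Proof.
have mt : measurable (`]-oo, t] `*` (setT : set E)) by exact: measurableX.
transitivity (Qk x (setT `\` (`]-oo, t] `*` setT))); last first.
  congr (Qk x _); apply/seteqP; split => -[a b] /=.
    rewrite in_itv/= => -[_ ta]; rewrite ltNge; apply/negP => ?; exact: ta.
  by rewrite in_itv/= ltNge => /negP ta; split => // -[/ta].
have QT : Qk x setT = 1 by exact: prob_kernel.
rewrite measureD ?setTI//; last by rewrite [ltLHS]QT ltry.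
by rewrite Qd_EFin//; congr (_ - _); rewrite -QT.
Qed.

(** The integral of [one_step] splits in two: the cost is rewritten by the tail formula, and the
    guard of the continuation is the restriction to [0, s]. *)
Lemma GopE u s x : (forall s x, 0 <= u s x) ->
  measurable_fun setT (uncurried u) ->
  Gop Qk c g u s x = Order.min (Hop u s x) (g x)%:E.
Proof.
move=> u0 mu; congr (Order.min _ _); rewrite /Hop /one_step/=.
rewrite ge0_integralD//=; last 4 first.
- by move=> p _; rewrite lee_fin stage_cost_ge0.
- apply/measurable_EFinP.
  exact: (measurable_fun_pair2 (s, x) measurable_stage_cost).
- by move=> p _; case: ifP.
- exact: (measurable_fun_pair2 (s, x) (measurable_continuation mu)).
congr (_ + _).
  under [RHS]eq_integral do rewrite /stage_cost EFinM.
  have mfst : measurable_fun setT (fst : (R * E)%type -> R) by [].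
  rewrite ge0_integralZl//; last 3 first.
  - apply/measurable_EFinP; apply: measurable_maxr => //.
    exact: measurable_minr.
  - by move=> p _; rewrite lee_fin le_max lexx.
  - by rewrite lee_fin.
  congr (_ * _).
  transitivity (\int[lebesgue_measure]_(t in `[0%R, s]) kprob Qk x [set p | t < p.1]%R).
    by apply: eq_integral => t _; rewrite EFinB Qd_compl.
  by rewrite -(truncated_tail_integral (kprob Qk x) s mfst).
rewrite integral_mkcond; apply: eq_integral => p _; rewrite patchE.
case: ifPn => [|]; rewrite ?inE ?notin_setE/= in_itv/= => H.
  by case: H => -> _.
by case: ifP => // h; exfalso; apply: H.
Qed.

End Operator.

(** * Value iteration *)

Section ValueIteration.
Context {R : realType} {d : measure_display} {E : measurableType d}.
Variables (Qk : R.-pker E ~> (R * E)%type) (c g : E -> R).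
Hypotheses (HQ0 : forall x : E, Qk x (`]-oo, 0] `*` setT) = 0%E)
  (mc : measurable_fun setT c) (mg : measurable_fun setT g)
  (c0 : forall x, 0 <= c x) (g0 : forall x, 0 <= g x).
Local Open Scope ereal_scope.
Local Notation uncurried u := (fun q : R * E => u q.1 q.2).
Implicit Types u v : R -> E -> \bar R.
Local Notation Hop := (Hop Qk c).
Local Notation Vn := (Vn Qk c g).

Lemma Hop_ge0 u s x : (forall s x, 0 <= u s x) -> 0 <= Hop u s x.
Proof. by move=> u0; apply: integral_ge0 => p _; exact: one_step_ge0. Qed.

(** The two properties are proved together because [GopE] needs both of them for V_n in order to
    unfold V_(n+1). *)
Lemma Vn_ge0_measurable n :
  (forall s x, 0 <= Vn n s x) /\ measurable_fun setT (uncurried (Vn n)).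
Proof.
elim: n => [|n [V0 mV]]; first by split => //; exact: measurable_cst.
have VE s x : Vn n.+1 s x = Order.min (Hop (Vn n) s x) (g x)%:E.
  exact: GopE.
split => [s x|]; first by rewrite VE le_min Hop_ge0//= lee_fin.
rewrite (_ : uncurried (Vn n.+1) =
    fun q => Order.min (Hop (Vn n) q.1 q.2) (g q.2)%:E); last first.
  by apply/funext => q; exact: VE.
apply: measurable_mine; first exact: measurable_Hop.
apply/measurable_EFinP.
exact: (measurableT_comp mg (@measurable_snd _ _ _ _)).
Qed.

Lemma Vn_ge0 n s x : 0 <= Vn n s x.
Proof. exact: (Vn_ge0_measurable n).1. Qed.

Lemma measurable_Vn n : measurable_fun setT (uncurried (Vn n)).
Proof. exact: (Vn_ge0_measurable n).2. Qed.

Lemma VnS n s x : Vn n.+1 s x = Order.min (Hop (Vn n) s x) (g x)%:E.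
Proof. by apply: GopE => //; [exact: Vn_ge0|exact: measurable_Vn]. Qed.

Lemma Vn_le_g n s x : Vn n s x <= (g x)%:E.
Proof. by case: n => [|n]; [rewrite lee_fin|rewrite VnS ge_min lexx orbT]. Qed.

Lemma measurable_one_step2 u s x : measurable_fun setT (uncurried u) ->
  measurable_fun setT (fun p => one_step c u ((s, x), p)).
Proof.
by move=> mu; exact: (measurable_fun_pair2 (s, x) (measurable_one_step mc mu)).
Qed.

Lemma Hop_le u v s x : (forall s x, 0 <= u s x) ->
  measurable_fun setT (uncurried u) -> measurable_fun setT (uncurried v) ->
  (forall s x, u s x <= v s x) -> Hop u s x <= Hop v s x.
Proof.
move=> u0 mu mv uv; apply: ge0_le_integral => //.
- by move=> p _; exact: one_step_ge0.
- exact: measurable_one_step2.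
- exact: measurable_one_step2.
- by move=> p _; rewrite leeD2l//; case: ifP.
Qed.

Lemma Vn_leS n s x : Vn n s x <= Vn n.+1 s x.
Proof.
elim: n s x => [|n IHn] s x; first exact: Vn_ge0.
rewrite VnS (VnS n.+1) le_min !ge_min lexx orbT andbT.
by rewrite Hop_le//; [exact: Vn_ge0|exact: measurable_Vn|exact: measurable_Vn].
Qed.

Lemma Vn_le m n s x : (m <= n)%N -> Vn m s x <= Vn n s x.
Proof.
elim: n => [|n IHn]; first by rewrite leqn0 => /eqP ->.
rewrite leq_eqVlt => /predU1P[-> //|]; rewrite ltnS => /IHn mn.
exact: le_trans mn (Vn_leS _ _ _).
Qed.

(** By [HQ0] the next jump comes at some t > 0 >= s, so no cost accrues and the continuation is cut
    off. [step_identity] asks this of [u]: nothing may be collected once T is reached. *)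
Lemma Vn_past n s x : (s <= 0)%R -> Vn n s x = 0.
Proof.
move=> s0; case: n => [//|n]; rewrite VnS.
suff -> : Hop (Vn n) s x = 0 by rewrite min_l// lee_fin.
have mN : measurable (`]-oo, (0 : R)%R] `*` (setT : set E)) by exact: measurableX.
rewrite /Hop (ge0_negligible_integral mN)//; last 2 first.
- exact: measurable_one_step2 (measurable_Vn n).
- by move=> p _; apply: one_step_ge0 => //; exact: Vn_ge0.
apply: integral0_eq => -[t y] /= [_]; rewrite in_itv/= => nt.
have t0 : (0 < t)%R by rewrite ltNge; apply/negP => ?; exact: nt.
rewrite /one_step/= /stage_cost [(t <= s)%R]leNgt (le_lt_trans s0 t0) andbF.
by rewrite max_l ?mulr0 ?adde0// ge_min s0 orbT.
Qed.

Section Contraction.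
Variable T : R.
Local Notation beta := (beta Qk T).

Lemma Qd_le1 t x : (Qd Qk t setT x <= 1)%R.
Proof.
have mt : measurable (`]-oo, t] `*` (setT : set E)) by exact: measurableX.
by rewrite -lee_fin Qd_EFin// (probability_le1 (kprob Qk x)).
Qed.

Lemma Qd_le_beta x : (Qd Qk T setT x <= beta)%R.
Proof.
apply: ub_le_sup; last by exists x.
by exists 1%R => _ [y _ <-]; exact: Qd_le1.
Qed.

Lemma beta_ge0 : (0 <= beta)%R.
Proof. by apply: le_trans (Qd_le_beta point); exact: Qd_ge0. Qed.

(** The excess [delta] is paid only if the jump falls in [0, s], which lies in ]-oo, T] and so has
    probability at most beta. After such a jump the remaining time is still at most T. *)
Lemma Hop_contraction u v (delta : R) s x : (0 <= delta)%R -> (s <= T)%R ->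
  (forall s x, 0 <= u s x) -> (forall s x, 0 <= v s x) ->
  measurable_fun setT (uncurried u) -> measurable_fun setT (uncurried v) ->
  (forall s x, (s <= T)%R -> u s x <= v s x + delta%:E) ->
  Hop u s x <= Hop v s x + (beta * delta)%:E.
Proof.
move=> delta0 sT u0 v0 mu mv uv.
have mT : measurable (`]-oo, T] `*` (setT : set E)) by exact: measurableX.
have mI : measurable_fun setT
    (fun p : R * E => delta%:E * (\1_(`]-oo, T] `*` (setT : set E)) p)%:E).
  exact/emeasurable_funM/measurable_EFinP/measurable_indic.
apply: (@le_trans _ _ (\int[Qk x]_p (one_step c v ((s, x), p) +
    delta%:E * (\1_(`]-oo, T] `*` (setT : set E)) p)%:E))).
  apply: ge0_le_integral => //.
  - by move=> p _; exact: one_step_ge0.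
  - exact: measurable_one_step2.
  - by apply: emeasurable_funD => //; exact: measurable_one_step2.
  move=> [t y] _; rewrite /one_step/= -addeA leeD2l//.
  case: ifPn => [/andP[t0 ts]|_]; last by rewrite add0e mule_ge0// lee_fin.
  rewrite indicE mem_set/= ?mule1; last by split => //=; rewrite in_itv/= (le_trans ts).
  by apply: uv; rewrite lerBlDr (le_trans sT)// lerDl.
rewrite ge0_integralD//; last 3 first.
- by move=> p _; exact: one_step_ge0.
- exact: measurable_one_step2.
- by move=> p _; rewrite mule_ge0// lee_fin.
rewrite leeD2l// ge0_integralZl//; last first.
  exact/measurable_EFinP/measurable_indic.
rewrite integral_indic// setIT -Qd_EFin// -EFinM lee_fin mulrC.
by rewrite ler_wpM2r// Qd_le_beta.
Qed.

Variable G : R.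
Hypothesis gG : forall x, (g x <= G)%R.

Let G0 : (0 <= G)%R. Proof. exact: le_trans (g0 point) (gG point). Qed.

(** Starts from V_1 <= g <= [G] and V_0 = 0. Each application of H shrinks the gap by beta, and the
    minimum with g does not enlarge it. *)
Lemma Vn_increment n s x : (s <= T)%R ->
  Vn n.+1 s x <= Vn n s x + (beta ^+ n * G)%:E.
Proof.
elim: n s x => [|n IHn] s x sT.
  by rewrite expr0 mul1r add0e (le_trans (Vn_le_g _ _ _))// lee_fin.
have bG : (0 <= beta ^+ n * G)%R by rewrite mulr_ge0// exprn_ge0// beta_ge0.
rewrite VnS (VnS n) exprS -mulrA.
have H : Hop (Vn n.+1) s x <= Hop (Vn n) s x + (beta * (beta ^+ n * G))%:E.
  by apply: Hop_contraction => //; [exact: Vn_ge0|exact: Vn_ge0|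
    exact: measurable_Vn|exact: measurable_Vn].
rewrite {2}/Order.min; case: ifPn => _; first by rewrite ge_min H.
rewrite ge_min; apply/orP; right.
by rewrite -[leLHS]adde0 leeD2l// lee_fin mulr_ge0// beta_ge0.
Qed.

Lemma Vn_tail n k s x : (beta < 1)%R -> (s <= T)%R ->
  Vn (n + k) s x <= Vn n s x + (beta ^+ n * G / (1 - beta))%:E.
Proof.
move=> b1 sT; have b0 := beta_ge0; have b10 : (0 < 1 - beta)%R by rewrite subr_gt0.
(* The induction on [k] goes through with the exact finite geometric sum, which is then bounded by
   the full series. *)
suff H : Vn (n + k) s x <=
    Vn n s x + (beta ^+ n * G * ((1 - beta ^+ k) / (1 - beta)))%:E.
  apply: (le_trans H); rewrite leeD2l// lee_fin ler_wpM2l//.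
    by rewrite mulr_ge0// exprn_ge0.
  by rewrite -[leRHS]mul1r ler_wpM2r ?invr_ge0 ?(ltW b10)// gerBl exprn_ge0.
elim: k => [|k IHk].
  by rewrite addn0 expr0 subrr mul0r mulr0 adde0.
rewrite addnS (le_trans (Vn_increment _ _ sT))//.
rewrite (le_trans (leeD2r _ IHk))// -addeA leeD2l// -EFinD lee_fin.
rewrite exprD [(_ ^+ k.+1)%R]exprS le_eqVlt; apply/orP; left; apply/eqP; field.
by rewrite gt_eqF.
Qed.

End Contraction.

End ValueIteration.

(** * Rewards along a path *)

Lemma oinf_Some (Q : nat -> Prop) n :
  oinf Q = Some n <-> Q n /\ forall k, (k < n)%N -> ~ Q k.
Proof.
rewrite /oinf; case: pselect => [h|h]; last first.
  by split => // -[Qn _]; exfalso; apply: h; exists n.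
case: ex_minnP => m /asboolP Qm mmin; split => [[<-]|[Qn nQ]].
  split => // k km Qk; have := mmin k (asboolT Qk).
  by rewrite leqNgt km.
congr Some; apply/eqP; rewrite eqn_leq mmin ?asboolT//= leqNgt.
by apply/negP => /nQ.
Qed.

Lemma oinf_None (Q : nat -> Prop) : oinf Q = None <-> forall n, ~ Q n.
Proof.
rewrite /oinf; case: pselect => [h|h]; split => //.
  by case: h => n Qn /(_ n).
by move=> _ n Qn; apply: h; exists n.
Qed.

(** Turns the two infima of [tau_eps] into the single first time of [hitting_time]. *)
Lemma omin_oinf (P Q : nat -> Prop) :
  omin (oinf P) (oinf Q) = oinf (fun n => P n \/ Q n).
Proof.
case EP : (oinf P) => [m|]; case EQ : (oinf Q) => [n|] /=; apply/esym.
- move/oinf_Some: EP => [Pm mP]; move/oinf_Some: EQ => [Qn nQ].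
  apply/oinf_Some; rewrite /minn; case: ltnP => mn; split; try by [left|right].
    by move=> k km [/(mP _ km)//|]; apply: nQ; exact: ltn_trans mn.
  by move=> k kn [|/(nQ _ kn)//]; apply: mP; exact: leq_trans mn.
- move/oinf_Some: EP => [Pm mP]; move/oinf_None: EQ => nQ.
  by apply/oinf_Some; split; [left|move=> k km [/(mP _ km)|/nQ]].
- move/oinf_None: EP => nP; move/oinf_Some: EQ => [Qn nQ].
  by apply/oinf_Some; split; [right|move=> k kn [/nP|/(nQ _ kn)]].
- move/oinf_None: EP => nP; move/oinf_None: EQ => nQ.
  by apply/oinf_None => n [/nP|/nQ].
Qed.

(** * Lower integrals of possibly nonmeasurable functions *)

Section NonMeasurable.
Context {R : realType} {d : measure_display} {T : measurableType d}.
Variable m : {measure set T -> \bar R}.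
Local Open Scope ereal_scope.

(** The integral of a nonnegative function is a supremum over the simple functions below it, which
    is monotone by definition. *)
Lemma ge0_le_integral_nonmeasurable (f h : T -> \bar R) :
  (forall x, 0 <= f x) -> (forall x, f x <= h x) ->
  \int[m]_x f x <= \int[m]_x h x.
Proof.
move=> f0 fh; have h0 x : 0 <= h x by exact: le_trans (f0 x) (fh x).
rewrite !ge0_integralTE//; apply: ge_ereal_sup => _ [phi phif <-].
by apply: ereal_sup_ubound; exists phi => //= x; exact: le_trans (phif x) _.
Qed.

(* [f] need not be measurable: its integral is then a lower integral. *)
Lemma eq_integral_off_null (N : set T) (f h : T -> \bar R) :
  measurable N -> m N = 0 -> measurable_fun setT h ->
  (forall x, 0 <= f x) -> (forall x, 0 <= h x) ->
  (forall x, ~ N x -> f x = h x) -> \int[m]_x f x = \int[m]_x h x.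
Proof.
move=> mN N0 mh f0 h0 fh.
have aeN (k : T -> \bar R) : (forall x, ~ N x -> k x = h x) ->
    ae_eq m setT k h.
  by move=> kh; exists N; split => // x /= kxh; apply: contrapT => /kh H; apply: kxh.
have mE (a : \bar R) :
    measurable_fun setT (fun x => if x \in N then a else h x).
  apply: measurable_fun_ifT => //.
  apply: (measurable_fun_bool true); rewrite setTI.
  by rewrite (_ : _ @^-1` _ = N)//; apply/seteqP; split => x /=; [exact: set_mem|exact: mem_set].
apply/eqP; rewrite eq_le; apply/andP; split.
  (* [f] lies between the two measurable functions obtained from [h] by writing +oo, respectively 0,
     on the null set. *)
  apply: (@le_trans _ _ (\int[m]_x (if x \in N then +oo else h x))).
    apply: ge0_le_integral_nonmeasurable => // x.
    by case: ifPn => [_|]; [rewrite leey|rewrite notin_setE => /fh ->].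
  rewrite (@ge0_ae_eq_integral _ _ _ m setT _ h)//.
    by move=> x _; case: ifP.
  by apply: aeN => x Nx /=; rewrite memNset.
apply: (@le_trans _ _ (\int[m]_x (if x \in N then 0 else h x))).
  rewrite (@ge0_ae_eq_integral _ _ _ m setT _ h)//.
    by move=> x _; case: ifP.
  by apply: aeN => x Nx /=; rewrite memNset.
apply: ge0_le_integral_nonmeasurable => x; first by case: ifP.
by case: ifPn => //; rewrite notin_setE => /fh ->.
Qed.

End NonMeasurable.

(** * Running cost along a path with positive sojourn times *)

Section Pathwise.
Context {R : realType} {d : measure_display} {E : measurableType d}.
Variable w : paths R E.
Hypothesis sojourn_gt0 : forall k, 0 < Tc k.+1 w.

Lemma Sc_lt k : Sc k w < Sc k.+1 w.
Proof. by rewrite ScS ltrDl. Qed.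

Lemma Sc_le m n : (m <= n)%N -> Sc m w <= Sc n w.
Proof.
by move: m n; apply/nondecreasing_seqP => k; exact/ltW/Sc_lt.
Qed.

Lemma Sc_ge0 k : 0 <= Sc k w.
Proof. by rewrite -(Sc0 w) Sc_le. Qed.

Lemma Xt_eq n t : Sc n w <= t < Sc n.+1 w -> Xt w t = Xc n w.
Proof.
move=> tn; rewrite /Xt (_ : oinf _ = Some n)//; apply/oinf_Some; split => // k kn.
move=> /andP[_ tk]; move: tn => /andP[nt _].
by have := le_lt_trans nt tk; rewrite ltNge Sc_le.
Qed.

Lemma Sc_locate n t : 0 <= t -> t < Sc n w ->
  exists2 k, (k < n)%N & Sc k w <= t < Sc k.+1 w.
Proof.
move=> t0; elim: n => [|n IHn]; first by rewrite Sc0 ltNge t0.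
have [tn _|nt tn] := ltP t (Sc n w); last by exists n => //; rewrite nt.
by have [k kn tk] := IHn tn; exists k => //; exact: ltnW.
Qed.

Variable c : E -> R.
Hypothesis c0 : forall x, 0 <= c x.

(** Before L, c(X(t)) is a step function, constant on each [S_k, S_(k+1)); the minima cut these
    intervals at L. *)
Lemma integral_running_cost n (L : R) : 0 <= L -> L <= Sc n w ->
  (\int[lebesgue_measure]_(t in `[0%R, L]) (c (Xt w t))%:E =
   \sum_(0 <= k < n)
     (c (Xc k w) * (Num.min (Sc k.+1 w) L - Num.min (Sc k w) L))%:E)%E.
Proof.
move=> L0 Ln.
pose I k := `[Sc k w, Sc k.+1 w[%classic : set R.
have eqX : {in `[0, L[%classic, (fun t => \sum_(0 <= k < n)
    (c (Xc k w))%:E * (\1_(I k) t)%:E)%E =1 (fun t => (c (Xt w t))%:E)}.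
  move=> t; rewrite inE/= in_itv/= => /andP[t0 tL].
  have [k kn tk] := Sc_locate t0 (lt_le_trans tL Ln).
  rewrite (Xt_eq tk) big_mkord (bigD1 (Ordinal kn))//= big1 ?adde0.
    by rewrite indicE mem_set ?mule1.
  move=> j jk; rewrite indicE memNset ?mule0// /I/= in_itv/=.
  move=> tj; have := Xt_eq tk.
  move: jk; rewrite -val_eqE/= neq_ltn => /orP[jk|kj].
    move: tj tk => /andP[_ tj] /andP[kt _].
    by have := lt_le_trans tj (Sc_le jk); rewrite ltNge kt.
  move: tj tk => /andP[jt _] /andP[_ tk].
  by have := lt_le_trans tk (Sc_le kj); rewrite ltNge jt.
have mI k : measurable (I k) by exact: measurable_itv.
have m1 D k : measurable_fun D (fun t : R => (\1_(I k) t)%:E).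
  exact/measurable_EFinP/measurable_indic.
have mT D k :
    measurable_fun D (fun t : R => ((c (Xc k w))%:E * (\1_(I k) t)%:E)%E).
  exact: emeasurable_funM.
have mS D : measurable_fun D (fun t : R => (\sum_(0 <= k < n)
    (c (Xc k w))%:E * (\1_(I k) t)%:E)%E).
  by apply: emeasurable_sum => k; exact: mT.
have mX : measurable_fun `[0, L[%classic (fun t => (c (Xt w t))%:E).
  exact: eq_measurable_fun eqX (mS _).
(* The endpoint is discarded because L = S_n is allowed, and then X(L) = X_n is not accounted for by
   the sum. *)
rewrite -integral_itv_bndo_bndc//.
under eq_integral do rewrite -eqX//.
rewrite ge0_integral_sum//; last 2 first.
- by move=> k; exact: mT.
- by move=> k t _; rewrite mule_ge0// lee_fin.
apply: eq_bigr => k _.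
rewrite ge0_integralZl//; last 2 first.
- exact: m1.
- by rewrite lee_fin.
rewrite EFinM integral_indic; [|exact: measurable_itv|exact: mI].
congr (_ * _)%E.
have [Sk Sk1] := (Sc_ge0 k, Sc_lt k).
transitivity (lebesgue_measure
   ([set` `[Sc k w, Num.min (Sc k.+1 w) L[] : set R)).
  congr (lebesgue_measure _); rewrite /I; apply/seteqP.
  split => t /=; rewrite !in_itv/= lt_min.
    by move=> [/andP[-> ->] /andP[_ ->]].
  by move=> /andP[Skt /andP[-> ->]]; rewrite Skt (le_trans Sk Skt).
rewrite lebesgue_measure_itv/= lte_fin lt_min Sk1/= -EFinB.
case: ltP => LSk; first by [].
by rewrite (min_r (le_trans LSk (ltW Sk1))) subrr.
Qed.

End Pathwise.

(** * Decomposition of the reward into stages *)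

Section Reward.
Context {R : realType} {d : measure_display} {E : measurableType d}.
Variables (c g : E -> R).
Hypotheses (c0 : forall x, 0 <= c x) (g0 : forall x, 0 <= g x).
Variable T : R.
Implicit Types (tau : paths R E -> option nat) (w : paths R E).

Definition before tau k w : bool :=
  if tau w is Some n then (k < n)%N else true.

(* What [reward] collects between S_k and S_(k+1). The guard [0 <= Sc k w] only
   discards paths with a negative sojourn time, a null set, and keeps the
   remaining time T - S_k in [0, T]. *)
Definition stage_reward tau k w : R :=
  if 0 <= Sc k w < T then
    if tau w == Some k then g (Xc k w)
    else if before tau k w then stage_cost c (T - Sc k w) (Xc k w) (Tc k.+1 w)
    else 0
  else 0.

Lemma stage_reward_ge0 tau k w : 0 <= stage_reward tau k w.
Proof.
rewrite /stage_reward; case: ifP => // _; case: ifP => // _; case: ifP => // _.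
exact: stage_cost_ge0.
Qed.

Lemma reward_ge0 tau w : (0 <= reward c g tau T w)%E.
Proof.
rewrite /reward; case: ifP => _.
  by rewrite adde_ge0 ?lee_fin// integral_ge0// => t _; rewrite lee_fin.
by apply: integral_ge0 => t _; rewrite lee_fin.
Qed.

(** Positive sojourns and a horizon reached after finitely many jumps. [value_stages] shows that
    this fails only inside a null set. *)
Definition regular_path w :=
  (forall k, 0 < Tc k.+1 w) /\ exists K, T <= Sc K w.

Lemma Sinf_ge k w : (forall k, 0 < Tc k.+1 w) -> ((Sc k w)%:E <= Sinf w)%E.
Proof.
move=> w0; rewrite /Sinf; apply: lime_ge.
  apply: ereal_nondecreasing_is_cvgn => m n mn; rewrite lee_fin.
  exact: Sc_le.
by near=> n; rewrite lee_fin Sc_le//; near: n; exact: nbhs_infty_ge.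
Unshelve. all: by end_near. Qed.

Lemma stage_cost_elapsed w k (x : E) : (forall k, 0 < Tc k.+1 w) -> Sc k w < T ->
  stage_cost c (T - Sc k w) x (Tc k.+1 w) =
  c x * (Num.min (Sc k.+1 w) T - Num.min (Sc k w) T).
Proof.
move=> w0 kT; rewrite /stage_cost (min_l (ltW kT)); congr (_ * _).
have Tk := w0 k; have -> : Sc k.+1 w = Sc k w + Tc k.+1 w by exact: ScS.
rewrite max_r; last by rewrite le_min ltW//= subr_ge0 ltW.
have [h|h] := leP (Tc k.+1 w) (T - Sc k w).
  by rewrite min_l; [rewrite addrAC subrr add0r|rewrite addrC -lerBrDr].
by rewrite min_r// addrC -lerBlDr ltW.
Qed.

(** The series is finite on such a path. If S_tau < T it ends with the term g(X_tau) at index tau;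
    otherwise it consists of the running costs of the stages started before T. *)
Lemma reward_stages tau w : 0 <= T -> regular_path w ->
  reward c g tau T w = (\sum_(0 <= k <oo) (stage_reward tau k w)%:E)%E.
Proof.
move=> T0 [w0 [K TK]].
have r0 k : (0 <= (stage_reward tau k w)%:E)%E by rewrite lee_fin stage_reward_ge0.
have split_at n : (forall k, (n <= k)%N -> stage_reward tau k w = 0) ->
    (\sum_(0 <= k <oo) (stage_reward tau k w)%:E =
     \sum_(0 <= k < n) (stage_reward tau k w)%:E)%E.
  move=> H; rewrite (@nneseries_split _ _ 0%N n)// add0n eseries0 ?adde0//.
  by move=> k nk _; rewrite H.
have SE n : tau w = Some n -> S_at tau w = (Sc n w)%:E by rewrite /S_at => ->.
rewrite /reward; case: ifPn => [ST|TS].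
  (* An infinite tau is excluded: S_tau would be the limit of the S_n, hence at least S_K >= T. *)
  case tw : (tau w) => [n|]; last first.
    move: ST; rewrite /S_at tw ltNge (le_trans _ (Sinf_ge K w0))//.
  move: ST; rewrite (SE _ tw) lte_fin => nT /=.
  rewrite (split_at n.+1); last first.
    move=> k nk; rewrite /stage_reward tw /before tw; case: ifP => // _.
    by rewrite eqE/= (ltn_eqF nk) ltnNge (ltnW nk).
  rewrite big_nat_recr//= {2}/stage_reward nT Sc_ge0//= tw eqxx; congr (_ + _)%E; last first.
    by rewrite (@Xt_eq _ _ _ _ w0 n)// lexx Sc_lt.
  rewrite (integral_running_cost w0 c0 (Sc_ge0 w0 n) (lexx _)).
  apply: eq_big_nat => k /andP[_ kn]; congr (_%:E).
  have kT : Sc k w < T by rewrite (le_lt_trans _ nT)// Sc_le// ltnW.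
  rewrite /stage_reward kT Sc_ge0//= /before tw eqE/= (gtn_eqF kn) kn stage_cost_elapsed//.
  rewrite !(min_l (ltW kT)) (min_l (Sc_le w0 (ltnW kn))) (min_l (Sc_le w0 kn)).
  by rewrite min_l// (le_trans (Sc_le w0 kn) (ltW nT)).
rewrite (split_at K); last first.
  move=> k Kk; rewrite /stage_reward ifF//.
  by apply/negbTE; rewrite negb_and -leNgt (le_trans TK) ?orbT// Sc_le.
rewrite (integral_running_cost w0 c0 T0 TK).
apply: eq_big_nat => k /andP[_ kK]; congr (_%:E).
rewrite /stage_reward Sc_ge0//=; case: ifPn => [kT|]; last first.
  by rewrite -leNgt => Tk; rewrite !min_r ?subrr ?mulr0// (le_trans Tk)// Sc_le.
rewrite -stage_cost_elapsed//.
case tw : (tau w) => [n|] /=; rewrite /before tw//.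
(* Stage k starts before T <= S_tau, so it comes before tau and g is not collected in it. *)
have kn : (k < n)%N.
  rewrite ltnNge; apply/negP => nk; move: TS.
  by rewrite (SE _ tw) lte_fin (le_lt_trans _ kT)// Sc_le.
by rewrite eqE/= (gtn_eqF kn) kn.
Qed.

Hypotheses (mc : measurable_fun setT c) (mg : measurable_fun setT g).

(** The complement {tau <= k} is a finite union of events {tau = n} with n <= k. *)
Lemma filtr_before tau k : stopping_time tau ->
  filtr k [set w | before tau k w].
Proof.
move=> st.
have mU (A : set (Filt R E k)) : measurable (~` A) -> measurable A.
  by move=> mA; rewrite -(setCK A); exact: measurableC.
suff : measurable (~` [set w | before tau k w] : set (Filt R E k)) by exact: mU.
rewrite (_ : ~` _ = \bigcup_(n in `I_k.+1) [set w | tau w = Some n]).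
  apply: bigcup_measurable => n nk; apply: (filtr_le (m := n)) => //.
apply/seteqP; split => w /=.
  rewrite /before; case tw : (tau w) => [n|] // /negP; rewrite -leqNgt => nk.
  by exists n.
by move=> [n /= nk tw]; rewrite /before tw; apply/negP; rewrite -leqNgt.
Qed.

Lemma measurable_stage_reward tau k : stopping_time tau ->
  measurable_fun setT (stage_reward tau k : Omega R E -> R).
Proof.
move=> st.
have mS : measurable_fun setT (Sc k : Omega R E -> R).
  by apply: (@measurable_filt_Omega _ _ _ k); exact: measurable_Sc.
have mX : measurable_fun setT (Xc k : Omega R E -> E).
  by apply: (@measurable_filt_Omega _ _ _ k); exact: measurable_Xc.
(* [stage_cost] ignores the state after the jump; [point] fills its slot so that
   [measurable_stage_cost] applies. *)
have mTX : measurable_fun setT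
    (fun w : Omega R E => (Tc k.+1 w, point : E)).
  apply: measurable_fun_pair => //; apply: (@measurable_filt_Omega _ _ _ k.+1).
  exact: measurable_Tc.
apply: measurable_fun_ifT => //.
  by apply: measurable_and; [exact: measurable_fun_ler|exact: measurable_fun_ltr].
apply: measurable_fun_ifT => //.
- apply: (measurable_fun_bool true); rewrite setTI.
  apply: (@filtr_measurable _ _ _ k).
  rewrite (_ : _ @^-1` _ = [set w | tau w = Some k])//.
  by apply/seteqP; split => w /= /eqP.
- exact: measurableT_comp.
apply: measurable_fun_ifT => //.
  apply: (measurable_fun_bool true); rewrite setTI.
  apply: (@filtr_measurable _ _ _ k).
  rewrite (_ : _ @^-1` _ = [set w | before tau k w])//.
  exact: filtr_before.
have mP : measurable_fun setT (fun w : Omega R E =>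
    ((T - Sc k w, Xc k w), (Tc k.+1 w, point : E))).
  apply: measurable_fun_pair => //; apply: measurable_fun_pair => //.
  exact: measurable_funB.
exact: (measurableT_comp (measurable_stage_cost mc) mP).
Qed.

End Reward.

(** * One step of the chain *)

Section Chain.
Context {R : realType} {d : measure_display} {E : measurableType d}.
Variables (Qk : R.-pker E ~> (R * E)%type) (c g : E -> R).
Hypotheses (HQ0 : forall x : E, Qk x (`]-oo, 0] `*` setT) = 0%E)
  (mc : measurable_fun setT c) (mg : measurable_fun setT g)
  (c0 : forall x, 0 <= c x) (g0 : forall x, 0 <= g x).
Variables (P : probability (Omega R E) R) (x0 : E).
Hypotheses
  (HP0 : forall B : set E, measurable B -> P (Xc 0 @^-1` B) = (\1_B x0)%:E)
  (HP1 : forall (n : nat) (A : set (Omega R E)), filtr n A ->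
    forall (t : R) (B : set E), measurable B ->
    P (A `&` [set w | Tc n.+1 w <= t /\ B (Xc n.+1 w)]) =
    (\int[P]_(w in A) (Qd Qk t B (Xc n w))%:E)%E).
Variable T : R.
Hypotheses (T0 : 0 <= T) (beta1 : beta Qk T < 1).
Local Open Scope ereal_scope.
Local Notation uncurried u := (fun q : R * E => u q.1 q.2).
Implicit Types (u : R -> E -> \bar R) (tau : paths R E -> option nat).
Local Notation beta := (beta Qk T).

Let mX k : measurable_fun setT (Xc k : Omega R E -> E).
Proof. by apply: (@measurable_filt_Omega _ _ _ k); exact: measurable_Xc. Qed.

Let mTc k : measurable_fun setT (Tc k : Omega R E -> R).
Proof. by apply: (@measurable_filt_Omega _ _ _ k); exact: measurable_Tc. Qed.

Let mS k : measurable_fun setT (Sc k : Omega R E -> R).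
Proof. by apply: (@measurable_filt_Omega _ _ _ k); exact: measurable_Sc. Qed.

Let mTle k t : measurable [set w : Omega R E | (Tc k w <= t)%R].
Proof.
have := mTc k measurableT (measurable_itv `]-oo, t]).
by rewrite setTI; congr measurable; apply/seteqP; split => w /=; rewrite in_itv.
Qed.

Definition degenerate : set (Omega R E) :=
  \bigcup_k [set w | (Tc k.+1 w <= 0)%R].

Lemma measurable_degenerate : measurable degenerate.
Proof.
by apply: bigcup_measurable => k _; exact: mTle.
Qed.

(** A countable union of events, each null by the Markov property at t = 0 and [HQ0]. *)
Lemma degenerate_null : P degenerate = 0.
Proof.
apply/(negligibleP _ measurable_degenerate)/negligible_bigcup => k.
apply/(negligibleP _ (mTle k.+1 0%R)).
have := @HP1 k setT (@measurableT _ (Filt R E k)) 0%R setT measurableT.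
rewrite setTI [X in P X](_ : _ = [set w | (Tc k.+1 w <= 0)%R]); last first.
  by apply/seteqP; split => w /=; [case|].
by move=> PE; apply: (eq_trans PE); apply: integral0_eq => w _; rewrite /Qd HQ0.
Qed.

Lemma nondegenerate (w : Omega R E) : ~ degenerate w -> forall k, (0 < Tc k.+1 w)%R.
Proof. by move=> nw k; rewrite ltNge; apply/negP => Tk; apply: nw; exists k. Qed.

Definition live k : set (Omega R E) := [set w | (0 <= Sc k w < T)%R].

Lemma filtr_live k : filtr k (live k).
Proof.
have := measurable_Sc (R := R) (E := E) (leqnn k) measurableT
  (measurable_itv `[0%R, T[).
by rewrite setTI (_ : _ @^-1` _ = live k).
Qed.

Lemma measurable_live k : measurable (live k).
Proof. exact: (filtr_measurable (@filtr_live k)). Qed.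

(* A jump occurs within time T with conditional probability at most beta. *)
Lemma live_decay k : P (live k) <= (beta ^+ k)%:E.
Proof.
elim: k => [|k IHk].
  by rewrite expr0; apply: probability_le1; exact: measurable_live.
(* Off [degenerate], S_(k+1) < T forces S_k < T and T_(k+1) <= T; the probability of [A] is given by
   [HP1]. *)
pose A := live k `&` [set w | (Tc k.+1 w <= T)%R].
have mA : measurable A by apply: measurableI => //; exact: measurable_live.
apply: (@le_trans _ _ (P (A `|` degenerate))).
  apply: le_measure; rewrite ?inE.
  - exact: measurable_live.
  - by apply: measurableU => //; exact: measurable_degenerate.
  move=> w /= /andP[_ kT]; have [dw|ndw] := pselect (degenerate w); first by right.
  have w0 := nondegenerate ndw; left; split => /=.
    by rewrite /live/= Sc_ge0//= (lt_trans _ kT)// Sc_lt.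
  move: kT; rewrite ScS => /ltW; apply: le_trans.
  by rewrite lerDr Sc_ge0.
rewrite (le_trans (measureU2 _ mA measurable_degenerate))//.
rewrite [X in _ + X]degenerate_null adde0.
have := @HP1 k (live k) (@filtr_live k) T setT measurableT.
rewrite [X in P X](_ : _ = A); last first.
  by apply/seteqP; split => w [? H]; split => //=; case: H.
move=> PA; apply: (@le_trans _ _ (\int[P]_(w in live k) beta%:E)).
  rewrite [leLHS]PA.
  apply: ge0_le_integral => //; first exact: measurable_live.
  - by move=> w _; rewrite lee_fin Qd_ge0.
  - apply: measurable_funTS.
    rewrite (_ : (fun w => _) = (fun y => Qk y (`]-oo, T] `*` setT)) \o (Xc k)).
      apply: (measurableT_comp (measurable_kernel Qk _ _)) => //.
      exact: measurableX.
    by apply/funext => w /=; rewrite Qd_EFin.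
  - by move=> w _; rewrite lee_fin Qd_le_beta.
rewrite integral_cst; last exact: measurable_live.
by rewrite exprS EFinM lee_wpmul2l// lee_fin beta_ge0.
Qed.

(** By the geometric decay with beta < 1, infinitely many jumps before T have probability zero. *)
Lemma always_live_null : P (\bigcap_k live k) = 0.
Proof.
have mI : measurable (\bigcap_k live k).
  by apply: bigcapT_measurable => k; exact: measurable_live.
apply/eqP; rewrite eq_le measure_ge0 andbT.
have H k : P (\bigcap_k live k) <= (beta ^+ k)%:E.
  apply: le_trans (live_decay k); apply: le_measure; rewrite ?inE//.
    exact: measurable_live.
  by move=> w; apply.
rewrite -(@fineK _ (P _)) ?fin_num_measure// lee_fin.
have b1 : (`|beta| < 1)%R by rewrite ger0_norm// beta_ge0.
apply: (cvgr_to_ge (cvg_expr b1)); apply: nearW => k.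
by rewrite -lee_fin fineK ?fin_num_measure.
Qed.

(** Monotone convergence applied to [reward_stages]. The reward itself is not shown to be
    measurable, so it is replaced by the series through [eq_integral_off_null]. *)
Lemma value_stages tau : stopping_time tau ->
  \int[P]_w reward c g tau T w =
  \sum_(0 <= k <oo) \int[P]_w (stage_reward c g T tau k w)%:E.
Proof.
move=> st; pose N := degenerate `|` \bigcap_k live k.
have mI : measurable (\bigcap_k live k).
  by apply: bigcapT_measurable => k; exact: measurable_live.
have mN : measurable N by apply: measurableU => //; exact: measurable_degenerate.
have msr k : measurable_fun setT
    (fun w : Omega R E => (stage_reward c g T tau k w)%:E).
  by apply/measurable_EFinP; exact: measurable_stage_reward.
have sr0 k w : 0 <= (stage_reward c g T tau k w)%:E.
  by rewrite lee_fin stage_reward_ge0.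
rewrite -integral_nneseries//.
apply: (@eq_integral_off_null _ _ _ P N) => //.
- apply/eqP; rewrite -measure_le0.
  rewrite (le_trans (measureU2 _ measurable_degenerate mI))//.
  by rewrite [X in X + _]degenerate_null [X in _ + X]always_live_null adde0.
- exact: ge0_emeasurable_sum.
- by move=> w; exact: reward_ge0.
- by move=> w; exact: nneseries_ge0.
move=> w nNw; apply: reward_stages => //.
have w0 : forall k, (0 < Tc k.+1 w)%R.
  by apply: nondegenerate => dw; apply: nNw; left.
split => //; apply: contrapT => /forallNP nT; apply: nNw; right => k _.
by rewrite /live/= Sc_ge0//= ltNge; apply/negP; exact: nT.
Qed.

Definition stopped tau k : set (Omega R E) :=
  live k `&` [set w | tau w = Some k].
Definition continuing tau k : set (Omega R E) :=
  live k `&` [set w | before tau k w].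

Lemma filtr_stopped tau k : stopping_time tau -> filtr k (stopped tau k).
Proof.
move=> st; apply: (@measurableI _ (Filt R E k)); first exact: filtr_live.
exact: st.
Qed.

Lemma filtr_continuing tau k : stopping_time tau -> filtr k (continuing tau k).
Proof.
move=> st; apply: (@measurableI _ (Filt R E k)); first exact: filtr_live.
exact: filtr_before.
Qed.

Lemma measurable_stopped tau k : stopping_time tau -> measurable (stopped tau k).
Proof. by move=> st; exact: (filtr_measurable (@filtr_stopped tau k st)). Qed.

Lemma measurable_continuing tau k :
  stopping_time tau -> measurable (continuing tau k).
Proof. by move=> st; exact: (filtr_measurable (@filtr_continuing tau k st)). Qed.

Definition to_go u k (w : Omega R E) : \bar R := u (T - Sc k w)%R (Xc k w).

Lemma measurable_to_go u k : measurable_fun setT (uncurried u) ->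
  measurable_fun setT (to_go u k).
Proof.
move=> mu; have mP : measurable_fun setT
    (fun w : Omega R E => ((T - Sc k w)%R, Xc k w)).
  by apply: measurable_fun_pair => //; exact: measurable_funB.
exact: (measurableT_comp mu mP).
Qed.

(** The domain of integration is the event tau >= k with S_k in [0, T), split according to whether
    tau = k. *)
Definition expected_to_go u tau k : \bar R :=
  \int[P]_(w in stopped tau k `|` continuing tau k) to_go u k w.

Lemma disjoint_stopped tau k : [disjoint stopped tau k & continuing tau k].
Proof.
apply/disj_setPS => w [[_ /= tw] [_ /=]].
by rewrite /before tw ltnn.
Qed.

Lemma expected_to_goE u tau k : stopping_time tau ->
  (forall s x, 0 <= u s x) -> measurable_fun setT (uncurried u) ->
  expected_to_go u tau k =
  \int[P]_(w in stopped tau k) to_go u k w +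
  \int[P]_(w in continuing tau k) to_go u k w.
Proof.
move=> st u0 mu; rewrite /expected_to_go ge0_integral_setU//.
- exact: measurable_stopped.
- exact: measurable_continuing.
- exact: measurable_funTS (measurable_to_go k mu).
- by move=> w _; exact: u0.
- exact: disjoint_stopped.
Qed.

Lemma beforeS tau k w : before tau k w <-> (tau w = Some k.+1 \/ before tau k.+1 w).
Proof.
rewrite /before; case: (tau w) => [n|]; last by split => // _; right.
split; first by rewrite leq_eqVlt => /predU1P[->|]; [left|right].
by case=> [[->]|/ltnW].
Qed.

(** On [continuing tau k], [markov_step] resolves H u into the cost of stage k and the value of [u]
    after the jump. The cost completes the stage reward; the other part is the expectation at k +
    1. *)
Lemma step_identity u tau k : stopping_time tau ->
  (forall s x, 0 <= u s x) -> measurable_fun setT (uncurried u) ->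
  (forall s x, (s <= 0)%R -> u s x = 0) ->
  \int[P]_w (stage_reward c g T tau k w)%:E + expected_to_go u tau k.+1 =
  \int[P]_(w in stopped tau k) (g (Xc k w))%:E +
  \int[P]_(w in continuing tau k) to_go (Hop Qk c u) k w.
Proof.
move=> st u0 mu upast.
have mst := @measurable_stopped tau k st.
have mco := @measurable_continuing tau k st.
have mst1 := @measurable_stopped tau k.+1 st.
have mco1 := @measurable_continuing tau k.+1 st.
pose cost (w : Omega R E) := stage_cost c (T - Sc k w) (Xc k w) (Tc k.+1 w).
pose cont (w : Omega R E) := if (0 <= Tc k.+1 w <= T - Sc k w)%R
  then u (T - Sc k w - Tc k.+1 w)%R (Xc k.+1 w) else 0.
have mP : measurable_fun setT (fun w : Omega R E =>
    (((T - Sc k w)%R, Xc k w), (Tc k.+1 w, Xc k.+1 w))).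
  apply: measurable_fun_pair; apply: measurable_fun_pair => //.
  exact: measurable_funB.
have mcost : measurable_fun setT (fun w => (cost w)%:E).
  apply/measurable_EFinP.
  exact: (measurableT_comp (measurable_stage_cost mc) mP).
have mcont : measurable_fun setT cont.
  exact: (measurableT_comp (measurable_continuation mu) mP).
have cost0 w : 0 <= (cost w)%:E by rewrite lee_fin stage_cost_ge0.
have cont0 w : 0 <= cont w by rewrite /cont; case: ifP.
have -> : \int[P]_(w in continuing tau k) to_go (Hop Qk c u) k w =
    \int[P]_(w in continuing tau k) (cost w)%:E +
    \int[P]_(w in continuing tau k) cont w.
  pose h (q : (R * E) * (R * E)) :=
    one_step c u (((T - q.1.1)%R, q.1.2), q.2).
  have mh : measurable_fun setT h.
    have mq : measurable_fun setT (fun q : (R * E) * (R * E) =>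
        (((T - q.1.1)%R, q.1.2), q.2)).
      apply: measurable_fun_pair => //; apply: measurable_fun_pair.
        apply: measurable_funB => //.
        exact: (measurableT_comp (@measurable_fst _ _ _ _)).
      exact: (measurableT_comp (@measurable_snd _ _ _ _)).
    exact: (measurableT_comp (measurable_one_step mc mu) mq).
  have h0 q : 0 <= h q by exact: one_step_ge0.
  rewrite -ge0_integralD//; last 2 first.
  - exact: measurable_funTS.
  - exact: measurable_funTS.
  exact/esym/(markov_step HP1 (@filtr_continuing tau k st) mh h0).
have -> : \int[P]_w (stage_reward c g T tau k w)%:E =
    \int[P]_(w in stopped tau k) (g (Xc k w))%:E +
    \int[P]_(w in continuing tau k) (cost w)%:E.
  have mgX : measurable_fun setT (fun w : Omega R E => (g (Xc k w))%:E).
    by apply/measurable_EFinP; exact: (measurableT_comp mg).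
  rewrite (integral_mkcond (stopped tau k)) (integral_mkcond (continuing tau k)).
  rewrite -ge0_integralD//; last 4 first.
  - by move=> w _; rewrite erestrict_ge0// => ? _; rewrite lee_fin.
  - by apply/(measurable_restrictT _ _).1 => //; exact: measurable_funTS.
  - by move=> w _; rewrite erestrict_ge0.
  - by apply/(measurable_restrictT _ _).1 => //; exact: measurable_funTS.
  apply: eq_integral => w _; rewrite /stage_reward !patchE.
  have [lw|nlw] := boolP (0 <= Sc k w < T)%R; last first.
    by rewrite !memNset ?adde0//; case=> lw _; move: nlw; rewrite lw.
  have [tw|/eqP tw] := eqVneq (tau w) (Some k).
    rewrite mem_set//= memNset ?adde0//.
    by case=> _ /=; rewrite /before tw ltnn.
  rewrite memNset/=; last by case.
  case: ifPn => bw; first by rewrite mem_set//= add0e.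
  by rewrite memNset ?adde0//; case=> _; rewrite /= (negbTE bw).
rewrite -addeA; congr (_ + (_ + _)).
(* What remains is compared path by path off [degenerate], where S_k < S_(k+1). *)
rewrite /expected_to_go integral_mkcond [RHS]integral_mkcond.
apply: (@eq_integral_off_null _ _ _ P degenerate).
- exact: measurable_degenerate.
- exact: degenerate_null.
- by apply/(measurable_restrictT _ _).1 => //; exact: measurable_funTS.
- by move=> w; rewrite erestrict_ge0// => ? _; exact: u0.
- by move=> w; rewrite erestrict_ge0.
move=> w /nondegenerate w0; rewrite !patchE /cont.
have TS : (T - Sc k w - Tc k.+1 w = T - Sc k.+1 w)%R by rewrite ScS opprD addrA.
(* The boundary case S_(k+1) = T passes the guard of [cont] but is not [live]; it is harmless
   because [u] vanishes at remaining time 0. *)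
have [kT|Tk] := ltP (Sc k.+1 w) T; last first.
  rewrite memNset; last first.
    by move=> [[/andP[_]]|[/andP[_]]]; rewrite ltNge Tk.
  case: ifP => // _; case: ifP => // _.
  by rewrite TS upast// subr_le0.
have kT' : (Tc k.+1 w <= T - Sc k w)%R by rewrite lerBrDl -ScS ltW.
rewrite kT' (ltW (w0 k))/= TS.
have lk : live k w by rewrite /live/= Sc_ge0//= (lt_trans (Sc_lt w0 k)).
have lk1 : live k.+1 w by rewrite /live/= Sc_ge0.
have [bw|nbw] := pselect (before tau k w).
  rewrite [X in if X then _ else _]mem_set; last first.
    by have [tw|bw1] := (beforeS tau k w).1 bw; [left|right].
  by rewrite mem_set.
rewrite [X in if X then _ else _]memNset; last first.
  by move=> [[_ tw]|[_ bw1]]; apply: nbw; apply/beforeS; [left|right].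
by rewrite memNset// => -[].
Qed.

End Chain.

(** * Bounds on the value of a stopping time *)

Section ValueBounds.
Context {R : realType} {d : measure_display} {E : measurableType d}.
Variables (Qk : R.-pker E ~> (R * E)%type) (c g : E -> R).
Hypotheses (HQ0 : forall x : E, Qk x (`]-oo, 0] `*` setT) = 0%E)
  (mc : measurable_fun setT c) (mg : measurable_fun setT g)
  (c0 : forall x, 0 <= c x) (g0 : forall x, 0 <= g x).
Variables (P : probability (Omega R E) R) (x0 : E).
Hypotheses
  (HP0 : forall B : set E, measurable B -> P (Xc 0 @^-1` B) = (\1_B x0)%:E)
  (HP1 : forall (n : nat) (A : set (Omega R E)), filtr n A ->
    forall (t : R) (B : set E), measurable B ->
    P (A `&` [set w | Tc n.+1 w <= t /\ B (Xc n.+1 w)]) =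
    (\int[P]_(w in A) (Qd Qk t B (Xc n w))%:E)%E).
Variable T : R.
Hypotheses (T0 : 0 <= T) (beta1 : beta Qk T < 1).
Local Open Scope ereal_scope.
Local Notation uncurried u := (fun q : R * E => u q.1 q.2).
Implicit Types (u : R -> E -> \bar R) (tau : paths R E -> option nat).
Local Notation beta := (beta Qk T).
Local Notation Vn := (Vn Qk c g).
Local Notation live := (live (E := E) T).
Local Notation stopped := (stopped (E := E) T).
Local Notation continuing := (continuing (E := E) T).
Local Notation to_go := (to_go T).
Local Notation expected_to_go := (expected_to_go P T).

Lemma initial_law (f : E -> \bar R) : measurable_fun setT f ->
  (forall x, 0 <= f x) -> \int[P]_w f (Xc 0 w) = f x0.
Proof.
move=> mf f0; have mX : measurable_fun setT (Xc 0 : Omega R E -> E).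
  by apply: (@measurable_filt_Omega _ _ _ 0%N); exact: measurable_Xc.
transitivity (\int[pushforward P (Xc 0 : Omega R E -> E)]_x f x).
  by rewrite ge0_integral_pushforward.
rewrite (@eq_measure_integral _ _ _ _ (dirac x0)); last first.
  by move=> A mA _ /=; rewrite /pushforward HP0// diracE.
by rewrite integral_dirac// diracT mul1e.
Qed.

Lemma stopped_continuing0 tau :
  stopped tau 0 `|` continuing tau 0 = live 0.
Proof.
apply/seteqP; split => [w [[]|[]]//|w lw].
case tw : (tau w) => [[|n]|]; [left|right|right]; split => //=;
  by rewrite /before tw.
Qed.

Lemma expected_to_go0 u tau : (0 < T)%R -> (forall s x, 0 <= u s x) ->
  measurable_fun setT (uncurried u) -> expected_to_go u tau 0 = u T x0.
Proof.
move=> Tgt0 u0 mu; rewrite /expected_to_go stopped_continuing0.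
rewrite (_ : live 0 = setT); last first.
  by apply/seteqP; split => // w _; rewrite /live/= Sc0 lexx.
transitivity (\int[P]_w u T (Xc 0 w)).
  by apply: eq_integral => w _; rewrite /to_go Sc0 subr0.
by apply: initial_law => //; exact: (measurable_fun_pair2 T mu).
Qed.

(** An inequality, in order to include T = 0, where [live 0] is empty. *)
Lemma expected_to_go0_le u tau : (forall s x, 0 <= u s x) ->
  measurable_fun setT (uncurried u) -> expected_to_go u tau 0 <= u T x0.
Proof.
move=> u0 mu; have [Tgt0|Tle0] := ltP 0%R T; first by rewrite expected_to_go0.
rewrite /expected_to_go stopped_continuing0 (_ : live 0 = set0).
  by rewrite integral_set0.
by apply/seteqP; split => // w; rewrite /live/= Sc0 lexx/= ltNge Tle0.
Qed.

Let mV n : measurable_fun setT (uncurried (Vn n)).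
Proof. exact: measurable_Vn. Qed.

Let V0 n s x : 0 <= Vn n s x.
Proof. exact: Vn_ge0. Qed.

Let mHV n : measurable_fun setT (uncurried (Hop Qk c (Vn n))).
Proof. exact: measurable_Hop. Qed.

Let HV0 n s x : 0 <= Hop Qk c (Vn n) s x.
Proof. exact: Hop_ge0. Qed.

Let mgX k : measurable_fun setT (fun w : Omega R E => (g (Xc k w))%:E).
Proof.
apply/measurable_EFinP; apply: (measurableT_comp mg).
by apply: (@measurable_filt_Omega _ _ _ k); exact: measurable_Xc.
Qed.

Let sr0 tau k : 0 <= \int[P]_w (stage_reward c g T tau k w)%:E.
Proof. by apply: integral_ge0 => w _; rewrite lee_fin stage_reward_ge0. Qed.

Let step tau k n : stopping_time tau ->
  \int[P]_w (stage_reward c g T tau k w)%:E + expected_to_go (Vn n) tau k.+1 =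
  \int[P]_(w in stopped tau k) (g (Xc k w))%:E +
  \int[P]_(w in continuing tau k) to_go (Hop Qk c (Vn n)) k w.
Proof. by move=> st; apply: step_identity => // s x; exact: Vn_past. Qed.

(** V_n is paid for by the next n stages: V_(n+1) is at most g where tau = k and at most H V_n where
    tau > k, and [step] moves on to k + 1 with V_n. *)
Lemma expected_to_go_le tau n k : stopping_time tau ->
  expected_to_go (Vn n) tau k <=
  \sum_(k <= j < k + n) \int[P]_w (stage_reward c g T tau j w)%:E.
Proof.
move=> st; elim: n k => [|n IHn] k.
  by rewrite addn0 big_geq// /expected_to_go integral0_eq.
rewrite big_ltn; last by rewrite addnS ltnS leq_addr.
rewrite addnS -addSn.
apply: (@le_trans _ _ (\int[P]_w (stage_reward c g T tau k w)%:E +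
  expected_to_go (Vn n) tau k.+1)); last by rewrite leeD2l.
rewrite step// expected_to_goE//; apply: leeD.
  apply: ge0_le_integral => //.
  - exact: measurable_stopped.
  - by move=> w _; exact: V0.
  - by apply: measurable_funTS; exact: measurable_to_go.
  - exact: measurable_funTS.
  - by move=> w _; exact: Vn_le_g.
apply: ge0_le_integral => //.
- exact: measurable_continuing.
- by move=> w _; exact: V0.
- by apply: measurable_funTS; exact: measurable_to_go.
- by apply: measurable_funTS; exact: measurable_to_go.
- by move=> w _; rewrite /to_go VnS// ge_min lexx.
Qed.

(** The case k = 0 of [expected_to_go_le], the partial sum being bounded by the series of
    [value_stages]. *)
Lemma Vn_le_value tau n : stopping_time tau ->
  Vn n T x0 <= \int[P]_w reward c g tau T w.
Proof.
move=> st; have [Tgt0|Tle0] := ltP 0%R T; last first.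
  by rewrite Vn_past//; apply: integral_ge0 => w _; exact: reward_ge0.
rewrite -(expected_to_go0 tau Tgt0 (V0 n) (mV n)).
rewrite (le_trans (expected_to_go_le n 0 st))// (value_stages HQ0)//.
by rewrite add0n; apply: nneseries_lim_ge => k _ _.
Qed.

Variable G : R.
Hypothesis gG : forall x, (g x <= G)%R.

(** * Upper bound for the entrance time into an abstract stopping region *)

Section Hitting.
Variables (D : set (R * E)) (m : nat) (tau : paths R E -> option nat).
Hypotheses (st : stopping_time tau)
  (V_in : forall s x, (0 < s <= T)%R -> D (s, x) -> Vn m.+1 s x = (g x)%:E)
  (V_out : forall s x, (0 < s <= T)%R -> ~ D (s, x) ->
     Vn m.+1 s x = Hop Qk c (Vn m) s x)
  (tau_in : forall k w, live k w -> tau w = Some k ->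
     D ((T - Sc k w)%R, Xc k w))
  (tau_out : forall k w, live k w -> before tau k w ->
     ~ D ((T - Sc k w)%R, Xc k w)).

Let G0 : (0 <= G)%R. Proof. exact: le_trans (g0 point) (gG point). Qed.

Let b0 : (0 <= beta)%R. Proof. exact: beta_ge0. Qed.

(** Bounds H V_(m+1) - H V_m on [0, T]: the increment bound for V_m, contracted once. *)
Let delta : R := (beta * (beta ^+ m * G))%R.

Let delta0 : (0 <= delta)%R.
Proof. by rewrite !mulr_ge0// exprn_ge0. Qed.

Let live_time k w : live k w -> (0 < T - Sc k w <= T)%R.
Proof. by move=> /andP[S0 ST]; rewrite subr_gt0 ST gerBl S0. Qed.

(** Before tau, H V_(m+1) <= H V_m + [delta] = V_(m+1) + [delta]. The error is paid only on live
    paths, whose probability [live_decay] bounds by beta^k. *)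
Lemma hitting_step k :
  \int[P]_w (stage_reward c g T tau k w)%:E + expected_to_go (Vn m.+1) tau k.+1
  <= expected_to_go (Vn m.+1) tau k + (delta * beta ^+ k)%:E.
Proof.
rewrite step// expected_to_goE// -[leRHS]addeA; apply: leeD.
  apply: ge0_le_integral => //.
  - exact: measurable_stopped.
  - by move=> w _; rewrite lee_fin.
  - exact: measurable_funTS.
  - by apply: measurable_funTS; exact: measurable_to_go.
  - move=> w [lw tw]; rewrite /to_go V_in//; first exact: live_time.
    exact: tau_in.
have mC : measurable (continuing tau k) by exact: measurable_continuing.
apply: (@le_trans _ _ (\int[P]_(w in continuing tau k)
    (to_go (Vn m.+1) k w + delta%:E))).
  apply: ge0_le_integral => //.
  - by move=> w _; exact: HV0.
  - by apply: measurable_funTS; exact: measurable_to_go.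
  - by apply: emeasurable_funD => //; apply: measurable_funTS;
      exact: measurable_to_go.
  - move=> w [lw bw]; have /andP[s0 sT] := live_time lw.
    rewrite /to_go V_out ?s0//; last exact: tau_out.
    apply: (@Hop_contraction _ _ _ _ _ mc c0 T) => //.
      by rewrite mulr_ge0// exprn_ge0.
    by move=> s x ?; exact: Vn_increment.
rewrite ge0_integralD//; last 2 first.
- by move=> w _; exact: V0.
- by apply: measurable_funTS; exact: measurable_to_go.
rewrite leeD2l// integral_cst// [leRHS]EFinM lee_wpmul2l ?lee_fin//.
apply: le_trans (live_decay HQ0 HP1 T k); apply: le_measure; rewrite ?inE//.
  exact: measurable_live.
by move=> w [].
Qed.

Lemma hitting_sum n :
  \sum_(0 <= k < n) \int[P]_w (stage_reward c g T tau k w)%:E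
    + expected_to_go (Vn m.+1) tau n <=
  Vn m.+1 T x0 + (delta * ((1 - beta ^+ n) / (1 - beta)))%:E.
Proof.
elim: n => [|n IHn].
  rewrite big_geq// add0e expr0 subrr mul0r mulr0 adde0.
  exact: expected_to_go0_le.
rewrite big_nat_recr//= -addeA (le_trans (leeD2l _ (hitting_step n)))// addeA.
rewrite (le_trans (leeD2r _ IHn))// -addeA leeD2l// -EFinD lee_fin.
rewrite exprS le_eqVlt; apply/orP; left; apply/eqP; field.
by rewrite subr_eq0 gt_eqF.
Qed.

(** The expectation left over in [hitting_sum] is nonnegative and dropped; the bound on the partial
    sums is then uniform in n. *)
Lemma hitting_value_le :
  \int[P]_w reward c g tau T w <=
  Vn m.+1 T x0 + (beta ^+ m.+1 * G / (1 - beta))%:E.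
Proof.
have b10 : (0 < 1 - beta)%R by rewrite subr_gt0.
rewrite (value_stages HQ0)//; apply: lime_le; first exact: is_cvg_nneseries.
apply: nearW => n.
apply: (@le_trans _ _ (\sum_(0 <= k < n)
  \int[P]_w (stage_reward c g T tau k w)%:E + expected_to_go (Vn m.+1) tau n)).
  by rewrite leeDl//; apply: integral_ge0 => w _; exact: V0.
rewrite (le_trans (hitting_sum n))// leeD2l// lee_fin exprS.
rewrite -[(beta * _ * G)%R]mulrA ler_wpM2l//.
by rewrite -[leRHS]mul1r ler_wpM2r ?invr_ge0 ?(ltW b10)// gerBl exprn_ge0.
Qed.

End Hitting.

End ValueBounds.

(** * Hitting times and optimality *)

Lemma le_supnorm (R : realType) d (E : measurableType d) (f : E -> R) x :
  (forall x, 0 <= f x) -> (exists K, forall x, f x <= K) -> f x <= supnorm f.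
Proof.
move=> f0 [K fK]; rewrite -[leLHS]ger0_norm//; apply: ub_le_sup; last by exists x.
by exists K => _ [y _ <-]; rewrite ger0_norm.
Qed.

Lemma le_natceil (R : realType) (y : R) : y <= (natceil y)%:R.
Proof.
rewrite /natceil; case: ltP => // y0.
rewrite (le_trans (ceil_ge y))// natr_absz ger0_norm// ceil_ge0.
by rewrite (lt_trans _ y0)// oppr_lt0.
Qed.

(** After taking logarithms, dividing by ln b < 0 reverses the inequality into the defining property
    of the ceiling. *)
Lemma expr_natceil_le (R : realType) (b a M : R) : 0 < b < 1 -> 0 < a ->
  0 < M -> b ^+ natceil ((ln a - ln M) / ln b) <= a / M.
Proof.
move=> b01 a0 M0; have lnb := ln_lt0 b01; have /andP[b0 _] := b01.
rewrite -ler_ln ?posrE ?exprn_gt0 ?divr_gt0// lnXn// ln_div ?posrE//.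
by rewrite -[leLHS]mulr_natl -ler_ndivrMr// le_natceil.
Qed.

(** * The choice of the number of iterations *)

Section Neps.
Context {R : realType} {d : measure_display} {E : measurableType d}.
Variables (Qk : R.-pker E ~> (R * E)%type) (c g : E -> R) (T eps : R).
Hypotheses (c0 : forall x, 0 <= c x) (g0 : forall x, 0 <= g x)
  (cb : exists K, forall x, c x <= K) (gb : exists K, forall x, g x <= K)
  (T0 : 0 <= T) (beta1 : beta Qk T < 1) (eps0 : 0 < eps).

(** N is chosen so that beta^N (M + 1) <= eps (1 - beta), and the supremum of g is at most M + 1. *)
Lemma Neps_bound :
  beta Qk T ^+ (Neps Qk c g T eps).+1 * supnorm g / (1 - beta Qk T) <= eps.
Proof.
have b0 := beta_ge0 Qk T; have b10 : 0 < 1 - beta Qk T by rewrite subr_gt0.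
rewrite ler_pdivrMr// /Neps.
(* For beta = 0 the exponent N + 1 = 1 is still positive, so the left side vanishes. *)
have [->|bn0] := eqVneq (beta Qk T) 0.
  by rewrite expr0n mul0r subr0 mulr1 ltW.
have nc : 0 <= supnorm c by exact: le_trans (c0 point) (le_supnorm _ c0 cb).
have ng : 0 <= supnorm g by exact: le_trans (g0 point) (le_supnorm _ g0 gb).
set M := T * supnorm c + supnorm g.
have M0 : 0 <= M by rewrite addr_ge0// mulr_ge0.
have b01 : 0 < beta Qk T < 1 by rewrite lt_neqAle eq_sym bn0 b0.
have a0 : 0 < eps * (1 - beta Qk T) by exact: mulr_gt0.
have M10 : 0 < M + 1 by rewrite ltr_wpDl.
have := expr_natceil_le b01 a0 M10; set n := natceil _; rewrite ler_pdivlMr// => H.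
apply: le_trans H; rewrite exprS -mulrA.
apply: (@le_trans _ _ (beta Qk T ^+ n * supnorm g)).
  by rewrite ler_piMl ?mulr_ge0 ?exprn_ge0 ?(ltW beta1).
rewrite ler_wpM2l ?exprn_ge0// (@le_trans _ _ M) ?lerDl//.
by rewrite lerDr mulr_ge0.
Qed.

End Neps.

(** * Hitting times as stopping times *)

Lemma stopping_time_oinf (R : realType) d (E : measurableType d)
    (Q : paths R E -> nat -> Prop) :
  (forall k, filtr k [set w | Q w k]) -> stopping_time (fun w => oinf (Q w)).
Proof.
move=> mQ n.
have -> : [set w | oinf (Q w) = Some n] =
    [set w | Q w n] `\` \bigcup_(k in `I_n) [set w | Q w k].
  apply/seteqP; split => w /=.
    by move=> /oinf_Some[Qn nQ]; split => // -[k /= kn]; exact: nQ.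
  move=> [Qn nQ]; apply/oinf_Some; split => // k kn Qk.
  by apply: nQ; exists k.
apply: (@measurableD _ (Filt R E n)); first exact: mQ.
apply: bigcup_measurable => k kn.
by apply: (@filtr_le _ _ _ k); [exact: ltnW|exact: mQ].
Qed.

Section HittingTime.
Context {R : realType} {d : measure_display} {E : measurableType d}.
Variables (D : set (R * E)) (T : R).
Hypothesis mD : measurable D.

Definition hitting_time (w : paths R E) : option nat :=
  oinf (fun n => D (T - Sc n w, Xc n w) \/ T <= Sc n w).

Lemma stopping_hitting_time : stopping_time hitting_time.
Proof.
apply: stopping_time_oinf => k.
have mS := @measurable_Sc R _ E k k (leqnn k).
have mX := @measurable_Xc R _ E k k (leqnn k).
apply: (@measurableU _ (Filt R E k)).
  have mP : measurable_fun setT (fun w : Filt R E k => (T - Sc k w, Xc k w)).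
    by apply: measurable_fun_pair => //; exact: measurable_funB.
  by have := mP measurableT D mD; rewrite setTI.
have := mS measurableT (`[T, +oo[%classic) (measurable_itv _).
rewrite setTI; congr measurable.
by apply/seteqP; split => w /=; rewrite in_itv/= andbT.
Qed.

Lemma hitting_time_in k w : live T k w -> hitting_time w = Some k ->
  D (T - Sc k w, Xc k w).
Proof. by move=> /andP[_ ST] /oinf_Some[[//|]]; rewrite leNgt ST. Qed.

Lemma hitting_time_out k w : live T k w -> before hitting_time k w ->
  ~ D (T - Sc k w, Xc k w).
Proof.
move=> lk; rewrite /before; case tw : (hitting_time w) => [n|] bk Dk.
  by move/oinf_Some: tw => [_ /(_ k bk)]; apply; left.
by move/oinf_None: tw => /(_ k); apply; left.
Qed.

End HittingTime.

(** [Gop] applied to V_N is V_(N+1) by definition of the iterates, so the region is a set where two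
    measurable functions agree. *)
Lemma measurable_Deps (R : realType) d (E : measurableType d)
    (Qk : R.-pker E ~> (R * E)%type) (c g : E -> R) (T eps : R) :
  measurable_fun setT c -> measurable_fun setT g ->
  (forall x, 0 <= c x) -> (forall x, 0 <= g x) ->
  measurable (Deps Qk c g T eps).
Proof.
move=> mc mg c0 g0; set N := Neps Qk c g T eps.
have -> : Deps Qk c g T eps = (`]0, T] `*` setT) `&`
    [set q | (g q.2)%:E = Vn Qk c g N.+1 q.1 q.2].
  by apply/seteqP; split => -[s x] /=; rewrite in_itv/=; [move=> []|move=> [[]]].
apply: measurable_eqe; first exact: measurableX.
  apply/measurable_EFinP/measurable_funTS.
  exact: (measurableT_comp mg (@measurable_snd _ _ _ _)).
by apply: measurable_funTS; exact: measurable_Vn.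
Qed.

Lemma Vn_continue (R : realType) d (E : measurableType d)
    (Qk : R.-pker E ~> (R * E)%type) (c g : E -> R) n s x :
  measurable_fun setT c -> measurable_fun setT g ->
  (forall x, 0 <= c x) -> (forall x, 0 <= g x) ->
  (g x)%:E <> Vn Qk c g n.+1 s x ->
  Vn Qk c g n.+1 s x = Hop Qk c (Vn Qk c g n) s x.
Proof. by move=> mc mg c0 g0; rewrite VnS//; case: leP. Qed.

Unset Implicit Arguments.

Theorem theorem4p5 (R : realType) (d : measure_display) (E : measurableType d)
  (HE : borel_space R E)
  (Qk : R.-pker E ~> (R * E)%type)
  (HQ0 : forall x : E, Qk x (`]-oo, 0] `*` setT) = 0%E)
  (c g : E -> R)
  (mc : measurable_fun setT c) (mg : measurable_fun setT g)
  (c0 : forall x, 0 <= c x) (g0 : forall x, 0 <= g x)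
  (cb : exists K, forall x, c x <= K) (gb : exists K, forall x, g x <= K)
  (P : E -> probability (Omega R E) R)
  (HP0 : forall (x : E) (B : set E), measurable B ->
     P x (Xc 0 @^-1` B) = (\1_B x)%:E)
  (HP1 : forall (x : E) (n : nat) (A : set (Omega R E)), filtr n A ->
     forall (t : R) (B : set E), measurable B ->
     P x (A `&` [set w | Tc n.+1 w <= t /\ B (Xc n.+1 w)]) =
     (\int[P x]_(w in A) (Qd Qk t B (Xc n w))%:E)%E)
  (T : R) (T0 : 0 <= T)
  (hbeta : beta Qk T < 1)
  (eps : R) (heps : 0 < eps) :
  let D := Deps Qk c g T eps in
  let GVN := Gop Qk c g (Vn Qk c g (Neps Qk c g T eps)) in
  let tau := tau_eps Qk c g T eps in
  (stopping_time tau /\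
   forall x : E, (value P c g tau T x <= Vstar P c g T x + eps%:E)%E) /\
  ((eps%:E < ereal_inf [set ((g sx.2)%:E - GVN sx.1 sx.2)%E |
                         sx in [set sx : R * E | (0 < sx.1 <= T)%R] `\` D])%E ->
   stopping_time tau /\ forall x : E, value P c g tau T x = Vstar P c g T x).
Proof.
move=> D GVN tau.
set N := Neps Qk c g T eps; pose V := Vn Qk c g; pose G := supnorm g.
have gG x : g x <= G by exact: le_supnorm.
have G0 : 0 <= G by exact: le_trans (g0 point) (gG point).
have b0 : 0 <= beta Qk T by exact: beta_ge0.
have b10 : 0 < 1 - beta Qk T by rewrite subr_gt0.
have NE : beta Qk T ^+ N.+1 * G / (1 - beta Qk T) <= eps by exact: Neps_bound.
have mD : measurable D by exact: measurable_Deps.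
have tauE : tau = hitting_time D T.
  by apply/funext => w; rewrite /tau /tau_eps omin_oinf.
have st : stopping_time tau by rewrite tauE; exact: stopping_hitting_time.
have low x n : (V n T x <= Vstar P c g T x)%E.
  apply: le_ereal_inf_tmp => _ [sigma ssigma <-].
  by apply: (Vn_le_value HQ0 mc mg c0 g0 (HP0 x) (HP1 x) T0 hbeta).
(* Common to (a) and (b): if [D] is the stopping region of V_(m+1), then the value of [tau] exceeds
   V_(m+1), hence also the optimal value, by at most the stated error. *)
have up m x :
    (forall s y, 0 < s <= T -> D (s, y) -> V m.+1 s y = (g y)%:E) ->
    (forall s y, 0 < s <= T -> ~ D (s, y) -> V m.+1 s y = Hop Qk c (V m) s y) ->
    (value P c g tau T x <=
     Vstar P c g T x + (beta Qk T ^+ m.+1 * G / (1 - beta Qk T))%:E)%E.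
  move=> Vin Vout; apply: le_trans (leeD2r _ (low x m.+1)).
  apply: (hitting_value_le HQ0 mc mg c0 g0 (HP0 x) (HP1 x) T0 hbeta gG st Vin Vout).
    by rewrite tauE => k w; exact: hitting_time_in.
  by rewrite tauE => k w; exact: hitting_time_out.
have Din s y : D (s, y) -> V N.+1 s y = (g y)%:E by move=> [_ ->].
have Dout s y : 0 < s <= T -> ~ D (s, y) -> (g y)%:E <> V N.+1 s y.
  by move=> sT nD gV; apply: nD; split.
split; first split=> // x.
  apply: (le_trans (up N x _ _)).
  - by move=> s y _; exact: Din.
  - by move=> s y sT /(Dout _ _ sT); exact: Vn_continue.
  - by rewrite leeD2l// lee_fin.
move=> gap; split=> // x; apply/eqP; rewrite eq_le; apply/andP; split; last first.
  by apply: ereal_inf_lbound; exists tau.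
(* It suffices to be within every e > 0 of the optimum, which is obtained by letting m grow. *)
apply/lee_addgt0Pr => e e0.
(* [D] remains the stopping region for every m >= N. On [D], V_(m+1) is squeezed between V_(N+1) = g
   and g; off [D], it stays below g because the gap exceeds eps. *)
have Ve m : (N <= m)%N -> (value P c g tau T x <=
     Vstar P c g T x + (beta Qk T ^+ m.+1 * G / (1 - beta Qk T))%:E)%E.
  move=> Nm; apply: up => s y sT.
    move=> /Din Dg; apply/eqP; rewrite eq_le; apply/andP; split.
      exact: Vn_le_g.
    by rewrite -Dg; apply: Vn_le.
  move=> nD; apply: Vn_continue => //.
  suff : (V m.+1 s y < (g y)%:E)%E by move=> Vg gV; move: Vg; rewrite gV ltxx.
  (* All later iterates together add at most the geometric tail, which [NE] bounds by eps. *)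
  have Vm : (V m.+1 s y <= V N.+1 s y + eps%:E)%E.
    have /andP[_ sT'] := sT.
    have := @Vn_tail _ _ _ _ _ _ mc mg c0 g0 T G gG N.+1 (m - N) s y hbeta sT'.
    rewrite addSn subnKC// => /le_trans; apply.
    by rewrite leeD2l// lee_fin.
  apply: (le_lt_trans Vm).
  have : (eps%:E < (g y)%:E - V N.+1 s y)%E.
    by apply: (lt_le_trans gap); apply: ereal_inf_lbound; exists (s, y).
  have Vfin : V N.+1 s y \is a fin_num.
    rewrite ge0_fin_numE; last exact: Vn_ge0.
    by apply: le_lt_trans (ltry (g y)); exact: Vn_le_g.
  by rewrite -(fineK Vfin) -EFinB -EFinD !lte_fin ltrBrDr addrC.
have b1 : `|beta Qk T| < 1 by rewrite ger0_norm.
have cvgb : beta Qk T ^+ n @[n --> \oo] --> 0 by exact: cvg_expr.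
(* The denominator is [G + 1] because [G] may be 0. *)
have e1 : 0 < e * (1 - beta Qk T) / (G + 1).
  by rewrite !mulr_gt0// invr_gt0 ltr_wpDl.
have [n _ nH] : \forall n \near \oo,
    beta Qk T ^+ n < e * (1 - beta Qk T) / (G + 1).
  exact: (cvgr_lt 0 cvgb _ e1).
pose m := maxn n N; apply: (le_trans (Ve m (leq_maxr _ _))).
rewrite leeD2l// lee_fin ler_pdivrMr//.
have : beta Qk T ^+ m.+1 < e * (1 - beta Qk T) / (G + 1).
  by apply: nH; rewrite /= (leq_trans (leq_maxl n N)).
rewrite ltr_pdivlMr ?ltr_wpDl// => /ltW; apply: le_trans.
by rewrite ler_wpM2l ?exprn_ge0// lerDl.
Qed.
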